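(* Let $d\ge1$, $x_0\in[0,1]^d$, $\sigma>0$, and suppose one observes $$Z(x)=\int_{[0,1]^d}\mathbf{1}_{[0,x_1]\times\cdots\times[0,x_d]}(u)\,s(u)\,du+\frac{\sigma}{\sqrt n}W(x),\qquad x=(x_1,\dots,x_d)\in[0,1]^d,$$ where $W$ is the standard Wiener process on $[0,1]^d$ and $s$ is continuous on $[0,1]^d$. Let $d_n$ denote the integer part of $\ln(n)/(d\ln(2))$ and let $\mathcal{M}=\{1,\dots,d_n\}$. For $m\in\mathcal{M}$ let $S_m$ be the space of piecewise constant functions on the dyadic cubes of side $2^{-m}$ of $[0,1]^d$. For $p\ge1$ define $$x_m=\frac{pd}{2}\ln(2^m)\quad(m\in\mathcal{M}),\qquad x_{j,m}=\frac{pd}{2}\ln(2^j)\quad((j,m)\in\mathcal{M}^2),$$ and let $\hat m$ and $\hat s_{\hat m}$ be the selected index and estimator described in the context, for the linear functional $T(s)=s(x_0)$. Then for all $\alpha\in\,]0,1]$ and $L>0$, for every integer $n\ge2$ such that $n/(\sigma^2\ln(n))\ge2^{d+2\alpha}L^{-2}$ and $L^2\le n^{\frac{2\alpha}{d}}\sigma^2\ln(n)$, $$\sup_{s\in\mathcal{H}_\alpha(L)}\mathbb{E}\big(|\hat s_{\hat m}(x_0)-s(x_0)|^p\big)\le C\,L^{\frac{pd}{d+2\alpha}}\Big(\frac{\sigma^2\ln n}{n}\Big)^{\frac{p\alpha}{2\alpha+d}}+C(\sigma)\frac{\ln n}{n^{p/2}},$$ where $C$ is a constant depending on $p,\alpha$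 and $d$, and $C(\sigma)$ is a constant depending on $\sigma$.
   Context: Hölder class: for $\alpha\in\,]0,1]$ and $L>0$, $$\mathcal{H}_\alpha(L)=\{f:[0,1]^d\to\mathbb{R}:\ |f(x)-f(y)|\le L\|x-y\|_\infty^\alpha\ \ \forall x,y\in[0,1]^d\},\qquad \|x-y\|_\infty=\max_{1\le i\le d}|x_i-y_i|.$$ Dyadic cubes: for $m\in\mathcal{M}$ and $\lambda=(k_1,\dots,k_d)\in\Lambda_m=\{0,1,\dots,2^m-1\}^d$, $I_\lambda=[\frac{k_1}{2^m},\frac{k_1+1}{2^m}[\times\cdots\times[\frac{k_d}{2^m},\frac{k_d+1}{2^m}[$, where the $i$-th factor is closed on the right when $k_i=2^m-1$. The functions $\phi_\lambda=2^{md/2}\mathbf{1}_{I_\lambda}$, $\lambda\in\Lambda_m$, form an orthonormal basis of $S_m$ in $\mathbb{L}_2([0,1]^d)$. Estimators: $\hat s_m=\sum_{\lambda\in\Lambda_m}\big(\int_{[0,1]^d}\phi_\lambda(u)\,dZ(u)\big)\phi_\lambda$. With $T(f)=f(x_0)$, put $$\sigma_m^2=\frac{\sigma^2}{n}\sum_{\lambda\in\Lambda_m}\phi_\lambda(x_0)^2,\qquad\sigma_{j,m}^2=\mathrm{Var}\big(T(\hat s_j)-T(\hat s_m)\big),$$ $$\mathrm{pen}(m)=\sqrt{2x_m}\,\sigma_m,\qquad H(j,m)=\sqrt{2x_{j,m}}\,\sigma_{j,m},$$ $$\widehat{\mathrm{Crit}}(m)=\sup_{j\ge m,\,j\in\mathcal{M}}\big[|T(\hat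 s_m)-T(\hat s_j)|-H(j,m)\big]+\mathrm{pen}(m),$$ $$\hat m=\inf\Big\{m\in\mathcal{M}:\ \widehat{\mathrm{Crit}}(m)\le\inf_{j\in\mathcal{M}}\widehat{\mathrm{Crit}}(j)+\frac1n\Big\}.$$ Constants: $C$ does not depend on $n,L,\sigma$; $C(\sigma)$ does not depend on $n,L$ (it may depend on the fixed $p,\alpha,d$). *)

(* Defs.v *)
From HB Require Import structures.
From mathcomp Require Import all_boot all_order all_algebra.
From mathcomp Require Import all_classical all_reals all_analysis.

Set Implicit Arguments.
Unset Strict Implicit.
Unset Printing Implicit Defensive.

Import Order.TTheory GRing.Theory Num.Theory.
Import numFieldNormedType.Exports.

Local Open Scope classical_set_scope.
Local Open Scope ring_scope.

(* Points of R^d are row vectors 'rV[R]_d; the library norm `|x| on them is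
   max_i |x_i|. *)

Definition unit_cube (R : realType) (d : nat) : set 'rV[R]_d :=
  [set x | forall i, 0 <= x ord0 i <= 1].

Definition holder_class (R : realType) (d : nat) (alpha L : R) :
    set ('rV[R]_d -> R) :=
  [set f | forall x y, unit_cube x -> unit_cube y ->
     `|f x - f y| <= L * `|x - y| `^ alpha].

Section lebesgue_rd.
Context (R : realType).
Let T : measurableType _ := measurableTypeR R.

Definition tuple_of_pair (d : nat) (x : T * d.-tuple T) : d.+1.-tuple T :=
  [the d.+1.-tuple T of x.1 :: x.2].

Lemma measurable_tuple_of_pair (d : nat) :
  measurable_fun [set: T * d.-tuple T] (@tuple_of_pair d).
Proof. by apply: measurable_cons; [exact: measurable_fst|exact: measurable_snd]. Qed.

Definition lebesgue_cons (d : nat) (mu : {measure set (d.-tuple T) -> \bar R}) :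
    set (d.+1.-tuple T) -> \bar R :=
  pushforward ((@lebesgue_measure R) \x^ mu)%E (@tuple_of_pair d).

HB.instance Definition _ (d : nat) (mu : {measure set (d.-tuple T) -> \bar R}) :=
  Measure.copy (lebesgue_cons mu)
    (measure_function_pushforward__canonical__measure_function_Measure
       ((@lebesgue_measure R) \x^ mu)%E (@measurable_tuple_of_pair d)).

(* Carried by d.-tuple R, which has the product sigma-algebra in the library;
   'rV[R]_d does not have one. The operation \x^ is the product measure. *)
Fixpoint lebesgue_rd (d : nat) : {measure set (d.-tuple T) -> \bar R} :=
  match d with
  | 0 => \d_([tuple] : 0.-tuple T)
  | d'.+1 => lebesgue_cons (lebesgue_rd d')
  end.

Definition row_of_tuple (d : nat) (u : d.-tuple T) : 'rV[R]_d :=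
  \row_i tnth u i.

Definition integral_unit_cube (d : nat) (f : 'rV[R]_d -> R) : R :=
  (\int[lebesgue_rd d]_(u in [set u | unit_cube (row_of_tuple u)])
     f (row_of_tuple u))%R.

End lebesgue_rd.

Section wiener.
Context (R : realType) (d0 : measure_display) (T : measurableType d0)
  (P : probability T R).

(* normal_prob mu 0 is not the Dirac mass at mu (it is the uniform law on
   [0, 1]), hence the case distinction. *)
Definition gaussian_law (mu s : R) (B : set R) : \bar R :=
  if s == 0 then \d_mu B else normal_prob mu s B.

Definition gaussian_rv (X : T -> R) : Prop :=
  measurable_fun [set: T] X /\
  exists mu s : R, 0 <= s /\
    forall B : set R, measurable B -> P (X @^-1` B) = gaussian_law mu s B.

Definition gaussian_process_on (I : Type) (D : set I) (X : I -> T -> R) : Prop :=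
  forall (k : nat) (c : 'I_k -> R) (t : 'I_k -> I), (forall j, D (t j)) ->
    gaussian_rv (fun w => \sum_(j < k) c j * X (t j) w).

Definition wiener_process (d : nat) (W : 'rV[R]_d -> T -> R) : Prop :=
  [/\ gaussian_process_on (@unit_cube R d) W,
      forall x, unit_cube x -> ('E_P[W x] = 0)%E,
      forall x y, unit_cube x -> unit_cube y ->
        covariance P (W x) (W y) =
          (\prod_(i < d) Num.min (x ord0 i) (y ord0 i))%:E
    & {ae P, forall w, {within @unit_cube R d, continuous (fun x => W x w)}}].

Definition observation (d n : nat) (sigma : R) (s : 'rV[R]_d -> R)
    (W : 'rV[R]_d -> T -> R) (x : 'rV[R]_d) (w : T) : R :=
  integral_unit_cube
    (fun u => \1_[set v : 'rV[R]_d | forall i, 0 <= v ord0 i <= x ord0 i] u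
              * s u)
  + sigma / Num.sqrt n%:R * W x w.

End wiener.

Section histograms.
Context (R : realType) (d : nat).

Definition dyadic_index (m : nat) := {ffun 'I_d -> 'I_(2 ^ m)}.

Definition dyadic_cube (m : nat) (lam : dyadic_index m) : set 'rV[R]_d :=
  [set x | forall i,
     (lam i)%:R / 2 ^+ m <= x ord0 i /\
     (if lam i == (2 ^ m).-1 :> nat
      then x ord0 i <= (lam i).+1%:R / 2 ^+ m
      else x ord0 i < (lam i).+1%:R / 2 ^+ m)].

Definition phi (m : nat) (lam : dyadic_index m) (x : 'rV[R]_d) : R :=
  2 `^ ((m * d)%:R / 2) * \1_(dyadic_cube lam) x.

(* Rectangular increment of z over the box with lower corner a and upper
   corner b: alternating sum of z over the 2^d corners. *)
Definition box_increment (z : 'rV[R]_d -> R) (a b : 'rV[R]_d) : R :=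
  \sum_(e : {ffun 'I_d -> bool})
    (-1) ^+ #|[pred i | ~~ e i]|
    * z (\row_i (if e i then b ord0 i else a ord0 i)).

(* The stochastic integral of phi_lambda against dZ. The integral of the
   indicator of a box against dZ is by definition the increment of Z over that
   box; faces of the box do not matter since Z is continuous. *)
Definition integral_phi_dZ (z : 'rV[R]_d -> R) (m : nat)
    (lam : dyadic_index m) : R :=
  2 `^ ((m * d)%:R / 2)
  * box_increment z (\row_i ((lam i)%:R / 2 ^+ m))
                    (\row_i ((lam i).+1%:R / 2 ^+ m)).

Definition s_hat (z : 'rV[R]_d -> R) (m : nat) (x : 'rV[R]_d) : R :=
  \sum_(lam : dyadic_index m) integral_phi_dZ z lam * phi lam x.

End histograms.

Section selection.
Context (R : realType) (d0 : measure_display) (T : measurableType d0)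
  (P : probability T R) (d n : nat) (sigma p : R) (x0 : 'rV[R]_d)
  (Z : 'rV[R]_d -> T -> R).

Definition dn : nat := Num.truncn (ln n%:R / (d%:R * ln 2) : R).

Definition models : set nat := [set m | (1 <= m <= dn)%N].

Definition T_hat (m : nat) (w : T) : R := s_hat (fun x => Z x w) m x0.

Definition sigma2_m (m : nat) : R :=
  sigma ^+ 2 / n%:R * \sum_(lam : dyadic_index d m) phi lam x0 ^+ 2.

Definition sigma2_jm (j m : nat) : R :=
  fine ('V_P[fun w => (T_hat j w - T_hat m w)%R])%E.

Definition x_m (m : nat) : R := p * d%:R / 2 * ln (2 ^+ m).

Definition x_jm (j m : nat) : R := p * d%:R / 2 * ln (2 ^+ j).

Definition pen (m : nat) : R :=
  Num.sqrt (2 * x_m m) * Num.sqrt (sigma2_m m).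

Definition pen_jm (j m : nat) : R :=
  Num.sqrt (2 * x_jm j m) * Num.sqrt (sigma2_jm j m).

Definition Crit (m : nat) (w : T) : R :=
  sup [set `|T_hat m w - T_hat j w| - pen_jm j m
      | j in [set j | (m <= j)%N /\ models j]]
  + pen m.

(* The least admissible index. At least one index is admissible when
   1 <= dn; the default dn of the minimum is then irrelevant. *)
Definition m_hat (w : T) : nat :=
  \big[minn/dn]_(1 <= m < dn.+1 |
      Crit m w <= inf [set Crit j w | j in models] + n%:R^-1) m.

End selection.

(* Main.v *)
Require Import Defs.
From HB Require Import structures.
From mathcomp Require Import all_boot all_order all_algebra.
From mathcomp Require Import all_classical all_reals all_analysis.
From mathcomp Require Import measurable_realfun ring lra.
Import Order.TTheory GRing.Theory Num.Theory.
Import numFieldNormedType.Exports.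
Local Open Scope classical_set_scope.
Local Open Scope ring_scope.
Set Implicit Arguments.
Unset Strict Implicit.
Unset Printing Implicit Defensive.

(** Write [T_hat m = mean_hat m + noise m], with [noise m] a centred Gaussian
variable of variance [K^2 2^(md)], [K = sigma / sqrt n]. By minimality of
[m_hat] and [pen_jm j m <= 2 * pen j], [T_hat (m_hat)] is within
[3 (Crit m + 1/n)] of [T_hat m] for every fixed [m]; and [Crit m] is at most
twice the bias of order [L 2^(-m alpha)], plus [pen m], plus the largest
positive part of [|noise j - noise m| - pen_jm j m] over [j >= m]. The weight
[x_jm] is exactly such that the [p]-th moment of each of these positive parts
is bounded by [C K^p], whence the term [ln n / n^(p/2)] after summing over the
[dn <= 2 ln n] indices [j]. It remains to choose [m] balancing [L 2^(-m alpha)]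
and [K sqrt (2^(md) ln n)]; the two conditions on [n] say that this [m] lies
between [1] and [dn]. *)

(** * Gaussian variables *)

(** A Gaussian law comes with two parameters [m] and [s], while [pen_jm] is calibrated by the true
    variance. The bridge is [E X = m] together with [s^2 <= Var X]; each follows by integrating
    [1 + y <= exp y], with exponents for which the reweighted normal density is again a multiple of
    a normal density, so that the integral is read off from its mass. The estimator at [x0] uses the
    data only through an alternating sum over the corners of one dyadic cube. On product functions
    such a sum factors over the coordinates. This turns the noiseless part into an average of the
    signal over the cube, and the Wiener covariance into the volume of the cube. Since [m_hat] is
    random, the risk is first dominated pointwise by a measurable expression attached to a fixed
    level, where a sum of [p]-th powers replaces the maximum over [j]; only then are integrals split
    and computed. *)

Lemma ge0_integral_normal_prob (R : realType) (m s : R) (f : R -> R) :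
  (forall x, 0 <= f x) -> measurable_fun [set: R] f ->
  (\int[normal_prob m s]_x (f x)%:E =
   \int[lebesgue_measure]_x (f x * normal_pdf m s x)%:E)%E.
Proof.
move=> f0 mf; have dom := normal_prob_dominates m s.
under [RHS]eq_integral do rewrite EFinM.
rewrite -(Radon_Nikodym_SigmaFinite.change_of_variables dom)//; last first.
  exact/measurable_EFinP.
have if' := Radon_Nikodym_SigmaFinite.f_integrable dom.
have mpdf := measurable_normal_pdf m s.
apply: ae_eq_integral => //.
- apply: emeasurable_funM; first exact/measurable_EFinP.
  exact: (measurable_int _ if').
- by apply: emeasurable_funM; exact/measurable_EFinP.
(* The Radon-Nikodym derivative and [normal_pdf] have the same integral over every measurable set,
   hence agree almost everywhere. *)
- apply: ae_eqe_mul2l; apply: integral_ae_eq => //.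
    exact/measurable_EFinP.
  by move=> E _ mE; rewrite -(Radon_Nikodym_SigmaFinite.f_integral dom).
Qed.

(** The integral of a nonnegative function is a supremum over the simple functions below it, so
    monotonicity holds without measurability. This form accommodates a risk that depends on
    [m_hat]. *)
Lemma le_ge0_integral {d0} {T : measurableType d0} {R : realType}
    (mu : {measure set T -> \bar R}) (f g : T -> \bar R) :
  (forall x, 0 <= f x)%E -> (forall x, f x <= g x)%E ->
  (\int[mu]_x f x <= \int[mu]_x g x)%E.
Proof.
move=> f0 fg; rewrite !ge0_integralTE// => [|x]; last exact: le_trans (fg x).
by apply: ereal_sup_le => _ [h hf <-]; exists h => // x; exact: le_trans (fg x).
Qed.

Section gaussian_law_integral.
Context (R : realType) (d0 : measure_display) (T : measurableType d0)
  (P : probability T R).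
Implicit Types (X : T -> R) (f g : R -> R).

Lemma ge0_integral_law X (nu : {measure set (measurableTypeR R) -> \bar R}) f :
  measurable_fun [set: T] X ->
  (forall B : set R, measurable B -> P (X @^-1` B) = nu B) ->
  (forall x, 0 <= f x) -> measurable_fun [set: R] f ->
  (\int[P]_w (f (X w))%:E = \int[nu]_x (f x)%:E)%E.
Proof.
move=> mX XB f0 mf.
pose Y : {RV P >-> measurableTypeR R} :=
  @mfun_Sub _ _ _ (measurableTypeR R) X (mem_set mX).
rewrite -(@eq_measure_integral _ _ _ _ nu (distribution P Y)); last first.
  by move=> A mA _; exact: XB.
by rewrite ge0_integral_distribution//; exact/measurable_EFinP.
Qed.

Lemma integral_law_normal_le X (m s : R) f g :
  s != 0 -> measurable_fun [set: T] X ->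
  (forall B : set R, measurable B -> P (X @^-1` B) = gaussian_law m s B) ->
  (forall x, 0 <= f x) -> measurable_fun [set: R] f ->
  (forall x, f x * normal_pdf m s x <= g x) ->
  (\int[P]_w (f (X w))%:E <= \int[lebesgue_measure]_x (g x)%:E)%E.
Proof.
move=> s0 mX XB f0 mf fg.
rewrite (@ge0_integral_law X (normal_prob m s))// => [|B mB]; last first.
  by rewrite XB// /gaussian_law (negbTE s0).
rewrite ge0_integral_normal_prob//.
apply: le_ge0_integral => x; rewrite lee_fin//.
by rewrite mulr_ge0// normal_pdf_ge0.
Qed.

Lemma integral_law_dirac X (m : R) f :
  measurable_fun [set: T] X ->
  (forall B : set R, measurable B -> P (X @^-1` B) = gaussian_law m 0 B) ->
  (forall x, 0 <= f x) -> measurable_fun [set: R] f ->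
  (\int[P]_w (f (X w))%:E = (f m)%:E)%E.
Proof.
move=> mX XB f0 mf.
rewrite (@ge0_integral_law X (\d_(m : measurableTypeR R)))// => [|B mB]; last first.
  by rewrite XB// /gaussian_law eqxx.
rewrite integral_dirac// ?diracT ?mul1e//.
exact/measurable_EFinP.
Qed.

End gaussian_law_integral.

Section normal_density.
Context (R : realType).
Implicit Types (m s t a x p : R).

Lemma normal_pdf_expR m s x : s != 0 ->
  normal_pdf m s x = normal_peak s * expR (- (x - m) ^+ 2 / (s ^+ 2 *+ 2)).
Proof. by move=> s0; rewrite normal_pdfE. Qed.

(** Completing the square: the exponential weight only moves the centre by [t * s^2], so exponential
    moments reduce to the unit mass of a density. *)
Lemma normal_pdf_tilt m s t x : s != 0 ->
  expR (t * (x - m)) * normal_pdf m s x =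
  expR (t ^+ 2 * s ^+ 2 / 2) * normal_pdf (m + t * s ^+ 2) s x.
Proof.
move=> s0; rewrite !normal_pdf_expR// mulrCA [RHS]mulrCA -!expRD.
by congr (_ * expR _); field.
Qed.

Lemma normal_peakZ r s : 0 < r -> normal_peak s = r * normal_peak (r * s).
Proof.
move=> r0; rewrite /normal_peak.
rewrite (_ : (r * s) ^+ 2 * pi *+ 2 = r ^+ 2 * (s ^+ 2 * pi *+ 2)); last by ring.
by rewrite sqrtrM ?sqr_ge0// sqrtr_sqr gtr0_norm// invfM mulVKf// gt_eqF.
Qed.

(** The weight is chosen so that the inverse variances add up to [(r * s)^-2]; its expectation is
    therefore [r]. As [r] tends to 1 the weight tends to 1. *)
Lemma normal_pdf_shrink m s r x : s != 0 -> 0 < r ->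
  expR (- ((r ^- 2 - 1) / (s ^+ 2 *+ 2)) * (x - m) ^+ 2) * normal_pdf m s x =
  r * normal_pdf m (r * s) x.
Proof.
move=> s0 r0; rewrite !normal_pdf_expR ?mulf_neq0 ?(gt_eqF r0)//.
rewrite (normal_peakZ s r0) mulrCA -expRD [RHS]mulrA.
by congr (_ * expR _); field; rewrite s0 gt_eqF.
Qed.

(** [ln x <= x], and [p x <= p^2 + x^2 / 4] because [(p - x / 2)^2 >= 0]. The factor [1/4] is half
    of the exponent of a standard normal density, so the other half remains integrable. *)
Lemma powR_le_gauss p x : 0 < p -> 0 <= x ->
  x `^ p <= expR (p ^+ 2 + x ^+ 2 / 4).
Proof.
move=> p0; rewrite le_eqVlt => /predU1P[<-|x0].
  by rewrite powR0 ?gt_eqF// expR_ge0.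
rewrite /powR gt_eqF// ler_expR.
have := ln_sublinear x0; have := sqr_ge0 (p - x / 2) => h1 h2.
have : p * ln x <= p * x by rewrite ler_pM2l// ltW.
by move: h1; rewrite sqrrB; nra.
Qed.

(* If [|x| = a + y] with [y >= 0] then [x^2 >= a^2 + y^2]; half of the factor
   [exp(-y^2/2s^2)] absorbs [y^p], the other half is a density of variance
   [2s^2] centred at [a] or [-a]. *)
Lemma powR_normal_pdf_le p s a x : 0 < p -> 0 < s -> 0 <= a ->
  Num.max 0 (`|x| - a) `^ p * normal_pdf 0 s x <=
  expR (p ^+ 2) * s `^ p * expR (- a ^+ 2 / (s ^+ 2 *+ 2)) * Num.sqrt 2 *
    (normal_pdf a (Num.sqrt 2 * s) x + normal_pdf (- a) (Num.sqrt 2 * s) x).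
Proof.
move=> p0 s0 a0; have sn0 : s != 0 by rewrite gt_eqF.
have r0 : 0 < Num.sqrt 2 :> R by rewrite sqrtr_gt0.
have rs0 : Num.sqrt 2 * s != 0 by rewrite mulf_neq0// gt_eqF.
have RHS0 c : 0 <= expR (p ^+ 2) * s `^ p * expR (- a ^+ 2 / (s ^+ 2 *+ 2)) *
   Num.sqrt 2 * normal_pdf c (Num.sqrt 2 * s) x.
  by rewrite !mulr_ge0 ?normal_pdf_ge0 ?powR_ge0 ?expR_ge0// ltW.
have main y : 0 <= y -> `|x| = a + y -> forall c, (x - c) ^+ 2 = y ^+ 2 ->
    y `^ p * normal_pdf 0 s x <=
    expR (p ^+ 2) * s `^ p * expR (- a ^+ 2 / (s ^+ 2 *+ 2)) * Num.sqrt 2 *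
    normal_pdf c (Num.sqrt 2 * s) x.
  move=> y0 xay c xc; rewrite !normal_pdf_expR// xc subr0 exprMn sqr_sqrtr//.
  rewrite (normal_peakZ s r0) -real_normK ?num_real// xay.
  have -> : y = s * (y / s) by rewrite mulrCA divff// mulr1.
  set z := y / s; have z0 : 0 <= z by rewrite divr_ge0// ltW.
  rewrite powRM// ?(ltW s0)//.
  have zp := powR_le_gauss p0 z0.
  rewrite [leLHS](_ : _ = (s `^ p * Num.sqrt 2 * normal_peak (Num.sqrt 2 * s)) *
    (z `^ p * expR (- (a + s * z) ^+ 2 / (s ^+ 2 *+ 2)))); last by ring.
  rewrite [leRHS](_ : _ = (s `^ p * Num.sqrt 2 * normal_peak (Num.sqrt 2 * s)) *
    (expR (p ^+ 2) * (expR (- a ^+ 2 / (s ^+ 2 *+ 2)) *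
     expR (- (s * z) ^+ 2 / (2 * s ^+ 2 *+ 2))))); last by ring.
  rewrite ler_wpM2l//.
    by rewrite !mulr_ge0 ?normal_peak_ge0 ?powR_ge0// ltW.
  apply: (@le_trans _ _ (expR (p ^+ 2 + z ^+ 2 / 4) *
     expR (- (a + s * z) ^+ 2 / (s ^+ 2 *+ 2)))).
    by rewrite ler_wpM2r ?expR_ge0.
  rewrite -!expRD ler_expR -subr_ge0.
  (* Once the squares cancel, only the cross term of [(a + s z)^2] is left, and it has the right
     sign. *)
  rewrite [leRHS](_ : _ = a * z / s); last by field.
  by rewrite !mulr_ge0// invr_ge0 ltW.
case: (leP (`|x| - a) 0) => [_|xa].
  by rewrite powR0 ?gt_eqF// mul0r mulrDr addr_ge0.
have xE : `|x| = a + (`|x| - a) by ring.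
rewrite mulrDr; case: (leP 0 x) => x0.
  apply: (le_trans (main _ (ltW xa) xE a _)); last by rewrite lerDl.
  by rewrite ger0_norm.
apply: (le_trans (main _ (ltW xa) xE (- a) _)); last by rewrite lerDr.
by rewrite ltr0_norm//; ring.
Qed.

End normal_density.

(** * Moments of Gaussian variables *)

Lemma Lfun2_sqr_lty d0 (T : measurableType d0) (R : realType)
    (P : probability T R) (f : T -> R) : measurable_fun [set: T] f ->
  (\int[P]_w (f w ^+ 2)%:E < +oo)%E -> f \in Lfun P 2%:E.
Proof.
move=> mf foo; rewrite inE; apply/andP; split; rewrite inE//=.
rewrite /finite_norm unlock poweR_lty//.
by under eq_integral do rewrite /= powR_mulrn// real_normK ?num_real//.
Qed.

Lemma Lfun2D d0 (T : measurableType d0) (R : realType)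
    (P : probability T R) (f g : T -> R) :
  f \in Lfun P 2%:E -> g \in Lfun P 2%:E -> f \+ g \in Lfun P 2%:E.
Proof. by move=> f2 g2; rewrite rpredD ?lee1n. Qed.

Lemma Lfun2B_cst d0 (T : measurableType d0) (R : realType)
    (P : probability T R) (f : T -> R) c :
  f \in Lfun P 2%:E -> f \- cst c \in Lfun P 2%:E.
Proof. by move=> f2; apply: (Lfun2D f2 (g := cst (- c))); exact: Lfun_cst. Qed.

(** [E Y <= E Y^+ <= \int Z]: passing through the positive part allows a signed lower bound such as
    [1 + y <= exp y] to be integrated. *)
Lemma expectation_le_ge0 d0 (T : measurableType d0) (R : realType)
    (P : probability T R) (Y Z : T -> R) c :
  Y \in Lfun P 1 -> (forall w, 0 <= Z w) ->
  (forall w, Y w <= Z w) -> (\int[P]_w (Z w)%:E <= c%:E)%E ->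
  ('E_P[Y] <= c%:E)%E.
Proof.
move=> Y1 Z0 YZ Zc; apply: le_trans Zc; rewrite unlock.
have iY := (Lfun1_integrable _ Y).1 Y1.
apply: (@le_trans _ _ (\int[P]_w ((EFin \o Y) ^\+ w))%E).
  rewrite [leLHS]integralE leeBlDr; last first.
    by apply: integrable_fin_num => //; exact: integrable_funeneg.
  by rewrite leeDl// integral_ge0.
apply: le_ge0_integral => w; first exact: funepos_ge0.
by rewrite unlock/= ge_max !lee_fin YZ Z0.
Qed.

Section gaussian_moments.
Context (R : realType) (d0 : measure_display) (T : measurableType d0)
  (P : probability T R) (X : T -> R) (m s : R).
Hypothesis mX : measurable_fun [set: T] X.
Hypothesis lawX : forall B : set R, measurable B ->
  P (X @^-1` B) = gaussian_law m s B.

Lemma gaussian_exp_le t :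
  (\int[P]_w (expR (t * (X w - m)))%:E <= (expR (t ^+ 2 * s ^+ 2 / 2))%:E)%E.
Proof.
have mf : measurable_fun [set: R] (fun x => expR (t * (x - m))).
  apply: measurableT_comp => //; apply: measurable_funM => //.
  exact: measurable_funB.
have [s0|s0] := eqVneq s 0.
  have lawX0 := lawX; rewrite s0 in lawX0.
  rewrite (integral_law_dirac mX lawX0 (fun x => expR_ge0 (t * (x - m))) mf).
  by rewrite subrr mulr0 s0 expr0n/= mulr0 mul0r.
apply: le_trans.
  apply: (integral_law_normal_le s0 mX lawX
    (f := fun x => expR (t * (x - m)))) => //.
  by move=> x; rewrite normal_pdf_tilt//; exact: lexx.
under eq_integral do rewrite EFinM.
rewrite integralZl//; last exact: integrable_normal_pdf.
by rewrite integral_normal_pdf mule1.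
Qed.

Lemma gaussian_shrink_le r : s != 0 -> 0 < r ->
  (\int[P]_w (expR (- ((r ^- 2 - 1) / (s ^+ 2 *+ 2)) * (X w - m) ^+ 2))%:E <=
   r%:E)%E.
Proof.
move=> s0 r0.
pose f x := expR (- ((r ^- 2 - 1) / (s ^+ 2 *+ 2)) * (x - m) ^+ 2).
have mf : measurable_fun [set: R] f.
  apply: measurableT_comp => //; apply: measurable_funM => //.
  by apply: measurable_funX; exact: measurable_funB.
apply: le_trans.
  apply: (integral_law_normal_le s0 mX lawX (f := f)) => //.
    by move=> x; exact: expR_ge0.
  by move=> x; rewrite normal_pdf_shrink//; exact: lexx.
under eq_integral do rewrite EFinM.
rewrite integralZl//; last exact: integrable_normal_pdf.
by rewrite integral_normal_pdf mule1.
Qed.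

(** [z^2 <= 2 exp z] for [z >= 0], so [(X - m)^2] is dominated by the exponentials with [t = 1] and
    [t = -1]. *)
Lemma gaussian_Lfun2 : X \in Lfun P 2%:E.
Proof.
have mY : measurable_fun [set: T] (fun w => X w - m) by exact: measurable_funB.
have -> : X = (fun w => X w - m) \+ cst m by apply/funext => w /=; rewrite subrK.
apply: Lfun2D; last exact: Lfun_cst.
apply: Lfun2_sqr_lty => //.
have me t : measurable_fun [set: T] (fun w => expR (t * (X w - m))).
  by apply: measurableT_comp => //; exact: measurable_funM.
apply: (@le_lt_trans _ _
  (\int[P]_w (2 * (expR (1 * (X w - m)) + expR (-1 * (X w - m))))%:E)%E).
  apply: le_ge0_integral => w; rewrite lee_fin ?sqr_ge0//.
  have key (z : R) : 0 <= z -> z ^+ 2 <= 2 * expR z.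
    by move=> /(@expR_ge1Dxn _ _ 1); rewrite (_ : 2`! = 2)%N//; lra.
  have := expR_ge0 (1 * (X w - m)); have := expR_ge0 (-1 * (X w - m)).
  case: (leP 0 (X w - m)) => [/key|]; first by rewrite mul1r; lra.
  by rewrite -oppr_gt0 => /ltW/key; rewrite sqrrN mulN1r; lra.
under eq_integral do rewrite EFinM.
rewrite ge0_integralZl//=; last first.
  by apply/measurable_EFinP; exact: measurable_funD.
under eq_integral do rewrite EFinD.
rewrite ge0_integralD//; try exact/measurable_EFinP.
rewrite lte_mul_pinfty// lte_add_pinfty//.
  exact: le_lt_trans (gaussian_exp_le _) (ltry _).
exact: le_lt_trans (gaussian_exp_le _) (ltry _).
Qed.

(* From [1 + tY <= exp(tY)] with [Y = X - m] and [t] of either sign, small. *)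
Lemma gaussian_mean : ('E_P[X] = m%:E)%E.
Proof.
have X2 := gaussian_Lfun2.
have Pfin : P [set: T] \is a fin_num := fin_num_measure P _ measurableT.
pose Y := X \- cst m.
have Y2 : Y \in Lfun P 2%:E by exact: Lfun2B_cst.
have Y1 := Lfun_subset12 Pfin Y2; have X1 := Lfun_subset12 Pfin X2.
have c1 c : cst c \in Lfun P 1 by exact: Lfun_cst.
have mY : measurable_fun [set: T] Y by exact: measurable_funB.
suff : ('E_P[Y] = 0)%E.
  rewrite expectationB// expectation_cst -(fineK (expectation_fin_num X1)).
  by rewrite -EFinB => -[] /eqP; rewrite subr_eq0 => /eqP ->.
rewrite -(fineK (expectation_fin_num Y1)); congr EFin.
set e := fine _.
have H t : 1 + t * e <= expR (t ^+ 2 * s ^+ 2 / 2).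
  rewrite -lee_fin EFinD EFinM fineK ?expectation_fin_num//.
  rewrite -(expectation_cst P 1) -expectationZl// -expectationD ?Lfun_scale//.
  apply: (@expectation_le_ge0 _ _ _ _ _ (fun w => expR (t * (X w - m)))).
  - by rewrite rpredD// Lfun_scale.
  - by move=> w; exact: expR_ge0.
  - by move=> w /=; rewrite mulrC; exact: expR_ge1Dx.
  - exact: gaussian_exp_le.
apply: contrapT => /eqP e0.
have e2 : 0 < e ^+ 2 by rewrite exprn_even_gt0.
(* In [H] take [t = k e]: the linear gain [k e^2] beats the quadratic cost [k^2 e^2 s^2 / 2] when
   [k] is small. This [k] makes [k s^2 < 1] and [k e^2 <= 1], which is all that the contradiction
   uses. *)
pose k := (1 + s ^+ 2 + e ^+ 2)^-1.
have D0 : 0 < 1 + s ^+ 2 + e ^+ 2 by have := sqr_ge0 s; lra.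
have k0 : 0 < k by rewrite invr_gt0.
have kD : k * (1 + s ^+ 2 + e ^+ 2) = 1 by rewrite mulVf// gt_eqF.
have Hk := H (k * e).
set y := (k * e) ^+ 2 * s ^+ 2 / 2 in Hk.
have : (1 + k * e * e) * (1 - y) <= 1.
  rewrite -[leRHS](expRxMexpNx_1 y).
  have p1 : 0 < 1 + k * e * e.
    by rewrite -mulrA -expr2 addr_gt0// mulr_gt0.
  have [y1|y1] := leP 0 (1 - y); last first.
    by rewrite (@le_trans _ _ 0)// ?mulr_ge0 ?expR_ge0// pmulr_rle0// ltW//.
  rewrite ler_pM//; first exact: ltW.
  exact: expR_ge1Dx.
rewrite /y; have := sqr_ge0 s => s2 {Hk}.
have ks : k * s ^+ 2 <= 1 by nra.
have ke : k * e ^+ 2 <= 1 by nra.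
have ks1 : k * s ^+ 2 < 1 by nra.
set E := e ^+ 2 in e2 ke kD *; set S := s ^+ 2 in s2 ks ks1 kD *.
rewrite [leLHS](_ : _ = 1 + k * E * (1 - k * S / 2 * (1 + k * E))); last first.
  by rewrite /E; field.
move=> h; have : k * E * (1 - k * S / 2 * (1 + k * E)) <= 0 by lra.
rewrite (pmulr_rle0 _ (mulr_gt0 k0 e2)) => {}h.
have : k * S / 2 * (1 + k * E) <= k * S / 2 * 2.
  by rewrite ler_wpM2l//; [nra|lra].
lra.
Qed.

(* From [1 - h Y^2 <= exp(-h Y^2)] with [h -> 0]; only this inequality between
   [s] and the variance is needed. *)
Lemma gaussian_variance_ge : s ^+ 2 <= fine ('V_P[X])%E.
Proof.
have X2 := gaussian_Lfun2.
have [->|s0] := eqVneq s 0; first by rewrite expr0n/= fine_ge0// variance_ge0.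
have Pfin : P [set: T] \is a fin_num := fin_num_measure P _ measurableT.
pose Y := (X \- cst m) * (X \- cst m).
have X2m : X \- cst m \in Lfun P 2%:E by exact: Lfun2B_cst.
have Y1 : Y \in Lfun P 1 by exact: Lfun2_mul_Lfun1.
have -> : ('V_P[X] = 'E_P[Y])%E by rewrite /variance unlock gaussian_mean.
set V := fine _.
have s2 : 0 < s ^+ 2 by rewrite exprn_even_gt0.
(* The shrinking weight gives [1 - h V <= r]; dividing by [1 - r] leaves an inequality that tends to
   [2 s^2 <= 2 V] as [r] tends to 1. *)
have H r : 0 < r -> r < 1 -> 2 * s ^+ 2 * r ^+ 2 <= V * (1 + r).
  move=> r0 r1; set h := (r ^- 2 - 1) / (s ^+ 2 *+ 2).
  have : 1 + - h * V <= r.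
    rewrite -lee_fin EFinD EFinM fineK ?expectation_fin_num//.
    rewrite -(expectation_cst P 1) -expectationZl//.
    rewrite -expectationD ?Lfun_scale ?Lfun_cst//.
    apply: (@expectation_le_ge0 _ _ _ _ _
      (fun w => expR (- h * (X w - m) ^+ 2))).
    - by rewrite rpredD ?Lfun_scale ?Lfun_cst.
    - by move=> w; exact: expR_ge0.
    - move=> w /=; rewrite -[Y w]/((X w - m) * (X w - m)) -expr2 mulrC.
      exact: expR_ge1Dx.
    - exact: gaussian_shrink_le.
  rewrite mulNr lerBlDl -lerBlDr.
  have -> : h * V = (1 - r) * (V * (1 + r)) / (2 * s ^+ 2 * r ^+ 2).
    by rewrite /h; field; rewrite s0 gt_eqF.
  have D0 : 0 < 2 * s ^+ 2 * r ^+ 2 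
    by apply: mulr_gt0; [exact: mulr_gt0|exact: exprn_gt0].
  by rewrite (ler_pdivlMr _ _ D0) ler_pM2l ?subr_gt0.
rewrite leNgt; apply/negP => Vs.
have V0 : 0 <= V by rewrite fine_ge0// expectation_ge0// => w; exact: sqr_ge0.
(* Instead of a limit, [r = 1 - dl]: to first order the left side of [H] is [2 S - 4 S dl = S + V],
   already larger than [2 V]. *)
set S := s ^+ 2 in s2 H Vs; pose dl := (S - V) / (4 * S).
have S4 : 0 < 4 * S by exact: mulr_gt0.
have dE : dl * (4 * S) = S - V by rewrite divfK// gt_eqF.
have dl0 : 0 < dl by rewrite divr_gt0 ?subr_gt0.
have dl1 : dl <= 1 / 4 by rewrite ler_pdivrMr//; lra.
have h : 2 * S * (1 - dl) ^+ 2 <= V * (1 + (1 - dl)) by apply: H; lra.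
have : 0 <= S * dl ^+ 2 by rewrite mulr_ge0 ?sqr_ge0// ltW.
have : 0 <= V * dl by rewrite mulr_ge0// ltW.
by move: h dE; rewrite !expr2; nra.
Qed.

End gaussian_moments.

(** The bound on densities holds with the parameter [s], the statement with the standard deviation
    [sd]. Since [s <= sd], both [s^p] and [exp(-(a sd)^2 / (2 s^2))] increase when [s] is replaced
    by [sd]. The constant 4 is the mass 2 of the two densities times [sqrt 2 <= 2]. *)
Lemma gaussian_excess_le (R : realType) d0 (T : measurableType d0)
    (P : probability T R) (X : T -> R) (p a : R) :
  gaussian_rv P X -> ('E_P[X] = 0)%E -> 0 < p -> 0 <= a ->
  let sd := Num.sqrt (fine ('V_P[X])%E) in
  (\int[P]_w (Num.max 0 (`|X w| - a * sd) `^ p)%:E <=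
   (4 * expR (p ^+ 2) * sd `^ p * expR (- a ^+ 2 / 2))%:E)%E.
Proof.
move=> [mX [m [s [s0 lawX]]]] X0 p0 a0; set sd := Num.sqrt _ => /=.
have m0 : m = 0 by move: X0; rewrite (gaussian_mean mX lawX) => -[].
subst m.
have ssd : s <= sd.
  rewrite -(ger0_norm s0) -sqrtr_sqr ler_wsqrtr//.
  exact: gaussian_variance_ge lawX.
have sd0 : 0 <= sd by exact: sqrtr_ge0.
pose f (x : R) := Num.max 0 (`|x| - a * sd) `^ p.
have f0 x : 0 <= f x by exact: powR_ge0.
have mf : measurable_fun [set: R] f.
  apply: (@measurableT_comp _ _ _ _ _ _ (fun x : R => x `^ p)) => //.
  apply: measurable_maxr => //; apply: measurable_funB => //.
move: s0 lawX; rewrite le_eqVlt => /predU1P[<- lawX|s0 lawX].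
  rewrite (integral_law_dirac mX lawX f0 mf) /f normr0 sub0r.
  rewrite max_l ?oppr_le0 ?mulr_ge0// powR0 ?gt_eqF// lee_fin.
  by rewrite !mulr_ge0 ?expR_ge0 ?powR_ge0.
have sn0 : s != 0 by rewrite gt_eqF.
set b := a * sd.
have b0 : 0 <= b by rewrite mulr_ge0.
apply: le_trans.
  apply: (integral_law_normal_le sn0 mX lawX (f := f)) => // x.
  exact: powR_normal_pdf_le.
under eq_integral do rewrite EFinM.
have ipdf c := integrable_normal_pdf c (Num.sqrt 2 * s).
rewrite integralZl//; last first.
  by under eq_fun do rewrite EFinD; apply: integrableD => //; exact: ipdf.
under eq_integral do rewrite EFinD.
rewrite integralD//; try exact: ipdf.
rewrite !integral_normal_pdf -EFinD -EFinM lee_fin.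
have sq2 : Num.sqrt 2 <= 2 :> R.
  have := sqr_sqrtr (ler0n R 2); have := sqrtr_ge0 (2 : R).
  by rewrite expr2; nra.
have -> : - b ^+ 2 / (s ^+ 2 *+ 2) = - a ^+ 2 / 2 * (sd / s) ^+ 2.
  by rewrite /b; field.
have sds : 1 <= (sd / s) ^+ 2.
  by rewrite expr_ge1// ?divr_ge0 ?(ltW s0)// ler_pdivlMr// mul1r.
have e1 : expR (- a ^+ 2 / 2 * (sd / s) ^+ 2) <= expR (- a ^+ 2 / 2).
  by rewrite ler_expR; have := sqr_ge0 a; nra.
have e2 : s `^ p <= sd `^ p by rewrite ge0_ler_powR ?nnegrE// ltW.
rewrite [leRHS](_ : _ = expR (p ^+ 2) * sd `^ p * expR (- a ^+ 2 / 2) * 2 *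
  (1 + 1)); last by ring.
by do !(apply: ler_pM => //; rewrite ?mulr_ge0 ?powR_ge0 ?expR_ge0 ?sqrtr_ge0//).
Qed.

(** * Integrals over dyadic cubes *)

Section boxes.
Context (R : realType).
Local Notation T := (measurableTypeR R).

Definition tuple_box (d : nat) (A : 'I_d -> set T) : set (d.-tuple T) :=
  [set u | forall i, A i (tnth u i)].

Lemma measurable_tuple_box d (A : 'I_d -> set T) :
  (forall i, measurable (A i)) -> measurable (tuple_box A).
Proof.
move=> mA.
have -> : tuple_box A = \bigcap_(i in [set: 'I_d]) ((@tnth d T)^~ i @^-1` A i).
  by apply/seteqP; split => u h i //=; exact: h.
apply: fin_bigcap_measurable => // i _.
by rewrite -[X in measurable X]setTI; exact: measurable_tnth.
Qed.

Lemma lebesgue_rd_box d (A : 'I_d -> set T) (l : 'I_d -> R) :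
  (forall i, measurable (A i)) ->
  (forall i, lebesgue_measure (A i) = (l i)%:E) ->
  lebesgue_rd R d (tuple_box A) = (\prod_(i < d) l i)%:E.
Proof.
elim: d A l => [|d IH] A l mA lA.
  rewrite big_ord0 /= diracE mem_set// => i.
  by have := ltn_ord i.
rewrite big_ord_recl EFinM -lA.
rewrite -(IH (fun i => A (lift ord0 i)))//.
rewrite -product_measure2E//; last by apply: measurable_tuple_box.
rewrite /= /lebesgue_cons /pushforward; congr (_ _).
apply/seteqP; split => -[x u] /=.
  move=> h; split; first exact: (h ord0).
  by move=> i; have := h (lift ord0 i); rewrite tnthS.
move=> [h0 h] i; case: (unliftP ord0 i) => [j ->|->]; last exact: h0.
by rewrite tnthS; exact: h.
Qed.

Definition cube_tuple d : set (d.-tuple T) :=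
  [set u | unit_cube (row_of_tuple u)].

Lemma cube_tupleE d : @cube_tuple d = tuple_box (fun=> `[0, 1]%classic).
Proof.
by apply/seteqP; split => u h i; have := h i; rewrite /= in_itv/= mxE.
Qed.

Lemma measurable_cube_tuple d : measurable (@cube_tuple d).
Proof. by rewrite cube_tupleE; exact: measurable_tuple_box. Qed.

Lemma cube_tuple_measure d : lebesgue_rd R d (@cube_tuple d) = 1%E.
Proof.
rewrite cube_tupleE (lebesgue_rd_box (l := fun=> 1))// ?big1// => i.
by rewrite lebesgue_measure_itv/= lte_fin ltr01 sube0.
Qed.

Lemma Rintegral_sum d0 (X : measurableType d0) (mu : {measure set X -> \bar R})
    (D : set X) I (r : seq I) (f : I -> X -> R) : measurable D ->
  (forall i, mu.-integrable D (EFin \o f i)) ->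
  (\int[mu]_(x in D) \sum_(i <- r) f i x)%R =
  \sum_(i <- r) (\int[mu]_(x in D) f i x)%R.
Proof.
move=> mD fi; elim: r => [|i r IH].
  rewrite big_nil; under eq_Rintegral do rewrite big_nil.
  by rewrite Rintegral_cst// mul0r.
rewrite big_cons -IH -RintegralD//; last first.
  rewrite [X in _.-integrable _ X](_ : _ = fun x => (\sum_(j <- r) (f j x)%:E)%E).
    by apply: integrable_sum => // j _; exact: fi.
  by apply/funext => x /=; rewrite sumEFin.
by apply: eq_Rintegral => x _; rewrite big_cons.
Qed.

End boxes.

(** * Alternating sums over the corners of a box *)

Section box_increments.
Context (R : realType) (d : nat).
Implicit Types (z : 'rV[R]_d -> R) (a b : 'rV[R]_d).

Definition corner a b (e : {ffun 'I_d -> bool}) : 'rV[R]_d :=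
  \row_i (if e i then b ord0 i else a ord0 i).

Definition corner_sign (e : {ffun 'I_d -> bool}) : R :=
  (-1) ^+ #|[pred i | ~~ e i]|.

(** Expansion of a product of differences: each corner selects one of two terms in every factor, and
    its sign counts the subtracted ones. Both the signal and the covariance are handled through this
    identity. *)
Lemma sum_corner_sign (g : 'I_d -> bool -> R) :
  \sum_(e : {ffun 'I_d -> bool}) corner_sign e * \prod_i g i (e i) =
  \prod_i (g i true - g i false).
Proof.
transitivity (\prod_(i < d) \sum_(t : bool) ((-1) ^+ (~~ t) * g i t)).
  rewrite bigA_distr_bigA; apply: eq_bigr => e _.
  rewrite big_split/=; congr (_ * _).
  rewrite /corner_sign -prodr_const big_mkcond/=.
  by apply: eq_bigr => i _; rewrite inE; case: (e i).
by apply: eq_bigr => i _; rewrite big_bool/= mul1r mulN1r.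
Qed.

Lemma box_incrementE z a b :
  box_increment z a b = \sum_e corner_sign e * z (corner a b e).
Proof. by []. Qed.

Lemma box_incrementD z1 z2 (k : R) a b :
  box_increment (fun x => z1 x + k * z2 x) a b =
  box_increment z1 a b + k * box_increment z2 a b.
Proof.
rewrite !box_incrementE mulr_sumr -big_split; apply: eq_bigr => e _.
by rewrite mulrDr mulrCA.
Qed.

Lemma box_increment_prod (h : 'I_d -> R -> R) a b :
  box_increment (fun x => \prod_i h i (x ord0 i)) a b =
  \prod_i (h i (b ord0 i) - h i (a ord0 i)).
Proof.
rewrite box_incrementE.
rewrite -(sum_corner_sign (fun i t => h i (if t then b ord0 i else a ord0 i))).
apply: eq_bigr => e _; congr (_ * _).
by apply: eq_bigr => i _; rewrite mxE.
Qed.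

Lemma unit_cube_corner a b e : unit_cube a -> unit_cube b ->
  unit_cube (corner a b e).
Proof. by move=> ca cb i; rewrite mxE; case: ifP => _; [exact: cb|exact: ca]. Qed.

(** The kernel is the Wiener covariance. In each coordinate the double difference of [min] is
    [b - 2 a + a = b - a], the variance of a Brownian increment. *)
Lemma box_increment2_min a b : (forall i, a ord0 i <= b ord0 i) ->
  box_increment (fun x => box_increment
    (fun y => \prod_i Num.min (x ord0 i) (y ord0 i)) a b) a b =
  \prod_i (b ord0 i - a ord0 i).
Proof.
move=> ab; under [X in box_increment X]eq_fun do
  rewrite (box_increment_prod (fun i y => Num.min (_ ord0 i) y)).
rewrite (box_increment_prod (fun i x =>
  Num.min x (b ord0 i) - Num.min x (a ord0 i))).
apply: eq_bigr => i _; have := ab i => abi.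
rewrite minxx (min_r abi) (min_l abi) minxx; ring.
Qed.

End box_increments.

Lemma mx_norm_le (R : realType) d (x : 'rV[R]_d) (r : R) : 0 <= r ->
  (forall i, `|x ord0 i| <= r) -> `|x| <= r.
Proof.
move=> r0 xr; have [->|] := eqVneq x 0; first by rewrite normr0.
rewrite -normr_eq0; change `|x| with (mx_norm x).
by move=> /mx_norm_neq0[[i j] ->] /=; rewrite (ord1 i).
Qed.

(** * Dyadic cubes and the histogram estimator *)

Section dyadic.
Context (R : realType) (d : nat).
Implicit Types (x u : 'rV[R]_d) (m : nat).

(** The cap at [(2 ^ m).-1] sends [t = 1] to the last interval, the one that is closed on the
    right. *)
Definition dyadic_coord m (t : R) : nat :=
  minn (Num.truncn (2 ^+ m * t)) (2 ^ m).-1.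

Lemma dyadic_coord_lt m (t : R) : (dyadic_coord m t < 2 ^ m)%N.
Proof. by rewrite -(prednK (expn_gt0 2 m : (0 < 2 ^ m)%N)) ltnS geq_minr. Qed.

Definition dyadic_of m x : dyadic_index d m :=
  [ffun i => Ordinal (dyadic_coord_lt m (x ord0 i))].

Lemma natr_exp2n m : (2 ^ m)%N%:R = 2 ^+ m :> R.
Proof. by rewrite natrX. Qed.

Lemma exp2n_gt0 m : 0 < 2 ^+ m :> R.
Proof. exact: exprn_gt0. Qed.

Lemma dyadic_cube_of m x : unit_cube x -> dyadic_cube (dyadic_of m x) x.
Proof.
move=> cx i; rewrite ffunE /= /dyadic_coord; have /andP[t0 t1] := cx i.
set t := x ord0 i in t0 t1 *; have p0 := exp2n_gt0 m.
have mt0 : 0 <= 2 ^+ m * t by rewrite mulr_ge0// ltW.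
have /andP[k1 k2] := truncn_itv mt0.
have lo k : (k%:R <= 2 ^+ m * t) -> k%:R / 2 ^+ m <= t.
  by rewrite ler_pdivrMr// mulrC.
have hi k : (2 ^+ m * t < k%:R) -> t < k%:R / 2 ^+ m.
  by rewrite ltr_pdivlMr// mulrC.
case: (leqP (Num.truncn (2 ^+ m * t)) (2 ^ m).-1) => h; split.
- exact: lo.
- by case: ifP => _; [apply/ltW|]; exact: hi.
- by apply: lo; apply: le_trans k1; rewrite ler_nat ltnW.
- by rewrite eqxx (prednK (expn_gt0 2 m : (0 < 2 ^ m)%N)) natr_exp2n divff// gt_eqF.
Qed.

Lemma dyadic_cube_uniq m (lam : dyadic_index d m) x : unit_cube x ->
  dyadic_cube lam x -> lam = dyadic_of m x.
Proof.
move=> cx lx; apply/ffunP => i; apply/val_inj; rewrite ffunE /= /dyadic_coord.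
have /andP[t0 t1] := cx i; have [] := lx i.
set t := x ord0 i in t0 t1 *; have p0 := exp2n_gt0 m.
have mt0 : 0 <= 2 ^+ m * t by rewrite mulr_ge0// ltW.
rewrite ler_pdivrMr// mulrC => lo.
have kt : (lam i <= Num.truncn (2 ^+ m * t))%N by rewrite truncn_ge_nat.
case: ifPn => [/eqP k1 _|kn].
  by rewrite -k1; apply/esym/minn_idPr.
rewrite ltr_pdivlMr// mulrC => hi.
rewrite (truncn_def (n := lam i)) ?lo//.
by apply/esym/minn_idPl; rewrite -ltnS (prednK (expn_gt0 2 m : (0 < 2 ^ m)%N)).
Qed.

Lemma dyadic_cube_indic m (lam : dyadic_index d m) x : unit_cube x ->
  \1_(dyadic_cube lam) x = (lam == dyadic_of m x)%:R :> R.
Proof.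
move=> cx; rewrite indicE; congr ((nat_of_bool _)%:R); case: eqP => [->|h].
  by rewrite mem_set//; exact: dyadic_cube_of.
by apply: contra_notF h => /set_mem; exact: dyadic_cube_uniq.
Qed.

Definition lower_corner m x : 'rV[R]_d :=
  \row_i ((dyadic_of m x i)%:R / 2 ^+ m).
Definition upper_corner m x : 'rV[R]_d :=
  \row_i ((dyadic_of m x i).+1%:R / 2 ^+ m).

Lemma upper_cornerE m x i :
  upper_corner m x ord0 i = lower_corner m x ord0 i + 2 ^- m.
Proof. by rewrite !mxE -natr1 mulrDl mul1r. Qed.

Lemma corner_bounds m x i : unit_cube x ->
  lower_corner m x ord0 i <= x ord0 i <= upper_corner m x ord0 i.
Proof.
move=> cx; rewrite !mxE; have [-> /=] := dyadic_cube_of m cx i.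
by case: ifP => // _ /ltW.
Qed.

Lemma unit_cube_lower_corner m x : unit_cube (lower_corner m x).
Proof.
move=> i; rewrite mxE divr_ge0//= ?(ltW (exp2n_gt0 m))//.
by rewrite ler_pdivrMr ?exp2n_gt0// mul1r -natr_exp2n ler_nat ltnW.
Qed.

Lemma unit_cube_upper_corner m x : unit_cube (upper_corner m x).
Proof.
move=> i; rewrite mxE divr_ge0//= ?(ltW (exp2n_gt0 m))//.
by rewrite ler_pdivrMr ?exp2n_gt0// mul1r -natr_exp2n ler_nat.
Qed.

Lemma dyadic_cube_norm m x u : unit_cube x ->
  (forall i, lower_corner m x ord0 i <= u ord0 i <= upper_corner m x ord0 i) ->
  `|u - x| <= 2 ^- m.
Proof.
move=> cx ux; apply: mx_norm_le; first by rewrite invr_ge0 ltW ?exp2n_gt0.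
move=> i; rewrite !mxE ler_norml.
by have := ux i; have := corner_bounds m i cx; rewrite upper_cornerE; lra.
Qed.

Lemma powR2_sqr m : 2 `^ ((m * d)%:R / 2) * 2 `^ ((m * d)%:R / 2) =
  2 ^+ (m * d) :> R.
Proof. by rewrite -powRD ?pnatr_eq0 ?implybT// -splitr powR_mulrn. Qed.

(** Exactly one cube contains [x], so one term survives; its two factors [2^(md/2)] multiply to the
    inverse of the volume. *)
Lemma s_hatE (z : 'rV[R]_d -> R) m x : unit_cube x ->
  s_hat z m x =
  2 ^+ (m * d) * box_increment z (lower_corner m x) (upper_corner m x).
Proof.
move=> cx; rewrite /s_hat (bigD1 (dyadic_of m x))//= big1 => [|lam /negbTE h].
  rewrite addr0 /integral_phi_dZ /phi dyadic_cube_indic// eqxx mulr1.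
  by rewrite mulrAC powR2_sqr.
by rewrite /phi dyadic_cube_indic// h !mulr0.
Qed.

Lemma sum_phi_sqr m x : unit_cube x ->
  \sum_(lam : dyadic_index d m) phi lam x ^+ 2 = 2 ^+ (m * d).
Proof.
move=> cx; rewrite (bigD1 (dyadic_of m x))//= big1 => [|lam /negbTE h].
  by rewrite addr0 /phi dyadic_cube_indic// eqxx mulr1 expr2 powR2_sqr.
by rewrite /phi dyadic_cube_indic// h mulr0 expr0n.
Qed.

Lemma prod_corner_diff m x :
  \prod_i (upper_corner m x ord0 i - lower_corner m x ord0 i) =
  2 ^- (m * d).
Proof.
under eq_bigr do rewrite upper_cornerE addrAC subrr add0r.
by rewrite prodr_const card_ord exprVn exprM.
Qed.

Local Notation T := (measurableTypeR R).

(* [f] is a pointwise limit of step functions on the dyadic cubes; the product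
   sigma-algebra on tuples makes these measurable. *)
Lemma measurable_holder (f : 'rV[R]_d -> R) (alpha L : R) : 0 < alpha ->
  0 <= L -> holder_class alpha L f ->
  measurable_fun (@cube_tuple R d) (fun u : d.-tuple T => f (row_of_tuple u)).
Proof.
move=> a0 L0 hf.
pose h k (u : d.-tuple T) := \sum_(lam : dyadic_index d k)
  f (\row_i ((lam i)%:R / 2 ^+ k)) * \1_(dyadic_cube lam) (row_of_tuple u).
apply: (@measurable_fun_cvg _ _ _ _ h) => [k|u cu].
  apply: measurable_sum => lam; apply: measurable_funM => //.
  pose A (i : 'I_d) : set T := if lam i == (2 ^ k).-1 :> nat
    then `[(lam i)%:R / 2 ^+ k, (lam i).+1%:R / 2 ^+ k]%classic
    else `[(lam i)%:R / 2 ^+ k, (lam i).+1%:R / 2 ^+ k[%classic.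
  rewrite (_ : (fun _ => _) = \1_(tuple_box A)).
    apply: measurable_indic; apply: measurable_tuple_box => i.
    by rewrite /A; case: ifP.
  apply/funext => v; rewrite !indicE; congr ((nat_of_bool _)%:R); apply/idP/idP.
    move/set_mem => hv; apply/mem_set => i; have := hv i; rewrite /A mxE.
    by case: ifP => _ [h1 h2]; rewrite /= in_itv/= h1.
  move/set_mem => hv; apply/mem_set => i; have := hv i; rewrite /A mxE.
  by case: ifP => _; rewrite /= in_itv/= => /andP[].
have hE k : h k u = f (lower_corner k (row_of_tuple u)).
  rewrite /h (bigD1 (dyadic_of k (row_of_tuple u)))//= big1 => [|lam /negbTE ne].
    by rewrite addr0 dyadic_cube_indic// eqxx mulr1.
  by rewrite dyadic_cube_indic// ne mulr0.
set c := f (row_of_tuple u).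
have cvgLq : L * (2 `^ (- alpha)) ^+ k @[k --> \oo] --> (0 : R).
  apply: cvg_geometric.
  rewrite ger0_norm ?powR_ge0// powRN invf_lt1 ?powR_gt0//.
  by rewrite /powR pnatr_eq0 expR_gt1 mulr_gt0 ?ln_gt0 ?ltr1n.
apply: (@squeeze_cvgr _ _ _ _ (fun k => c - L * (2 `^ (- alpha)) ^+ k)
  (fun k => c + L * (2 `^ (- alpha)) ^+ k)).
- apply: nearW => k; rewrite hE -ler_distlC distrC.
  have := hf _ _ (unit_cube_lower_corner k (row_of_tuple u)) cu.
  move=> /le_trans; apply; rewrite ler_wpM2l//.
  have -> : (2 `^ (- alpha)) ^+ k = (2 ^- k) `^ alpha.
    have -> : 2 ^- k = 2 `^ (- k%:R) :> R by rewrite powR_invn.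
    rewrite -(powR_mulrn k (powR_ge0 2 (- alpha))) -[LHS]powRrM -[RHS]powRrM.
    by congr powR; ring.
  have p0 : 0 <= 2 ^- k :> R by rewrite invr_ge0 ltW ?exp2n_gt0.
  rewrite ge0_ler_powR ?(ltW a0) ?nnegrE ?normr_ge0//.
  apply: dyadic_cube_norm => // i.
  by rewrite lexx upper_cornerE lerDl invr_ge0 ltW ?exp2n_gt0.
- by rewrite -[X in _ --> X]subr0; apply: cvgB; [exact: cvg_cst|exact: cvgLq].
- by rewrite -[X in _ --> X]addr0; apply: cvgD; [exact: cvg_cst|exact: cvgLq].
Qed.

End dyadic.

(** * The noiseless part and its approximation error *)

Section box_integral.
Context (R : realType) (d : nat).
Local Notation T := (measurableTypeR R).
Local Notation mu := (lebesgue_rd R d).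
Local Notation cube := (@cube_tuple R d).
Variables (f : 'rV[R]_d -> R) (alpha L : R).
Hypothesis alpha_gt0 : 0 < alpha.
Hypothesis L_ge0 : 0 <= L.
Hypothesis hf : holder_class alpha L f.
Implicit Types (x a b : 'rV[R]_d) (B : set (d.-tuple T)).

Lemma unit_cube_norm x y : unit_cube x -> unit_cube y -> `|x - y| <= 1.
Proof.
move=> cx cy; apply: mx_norm_le => // i; rewrite !mxE ler_norml.
by have := cx i; have := cy i; lra.
Qed.

Lemma holder_bounded : exists M : R,
  forall x, unit_cube x -> `|f x| <= M.
Proof.
have c0 : unit_cube (0 : 'rV[R]_d) by move=> i; rewrite mxE lexx ler01.
exists (`|f 0| + L) => x cx; rewrite -lerBlDl (le_trans (lerB_dist _ _))//.
apply: (le_trans (hf cx c0)); rewrite ler_piMr//.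
rewrite -[leRHS](_ : 1 `^ alpha = 1); last by rewrite powR1.
by rewrite ge0_ler_powR ?(ltW alpha_gt0) ?nnegrE// unit_cube_norm.
Qed.

Lemma integrable_indic_holder B (c : R) : measurable B ->
  mu.-integrable cube (EFin \o (fun u => \1_B u * (f (row_of_tuple u) - c))).
Proof.
move=> mB; have [M fM] := holder_bounded.
apply: measurable_bounded_integrable.
- exact: measurable_cube_tuple.
- by rewrite cube_tuple_measure ltry.
- apply: measurable_funM; first exact: measurable_indic.
  by apply: measurable_funB => //; exact: measurable_holder hf.
- exists (M + `|c|); split; rewrite ?num_real// => K MK u cu /=.
  apply: (le_trans _ (ltW MK)); rewrite normrM.
  apply: (@le_trans _ _ (1 * `|f (row_of_tuple u) - c|)).
    by rewrite ler_wpM2r// indicE; case: (_ \in _); rewrite ?normr1 ?normr0.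
  by rewrite mul1r (le_trans (ler_normB _ _))// lerD2r fM.
Qed.

Lemma Rintegral_indic B : measurable B -> B `<=` cube ->
  (\int[mu]_(u in cube) (\1_B u : R))%R = fine (mu B).
Proof.
move=> mB BC; rewrite /Rintegral integral_indic//; last exact: measurable_cube_tuple.
by rewrite setIidl.
Qed.

Lemma integral_indic_holder B (c dl : R) : measurable B -> B `<=` cube ->
  (forall u, B u -> `|f (row_of_tuple u) - c| <= dl) ->
  `|(\int[mu]_(u in cube) (\1_B u * f (row_of_tuple u)))%R - c * fine (mu B)|
  <= dl * fine (mu B).
Proof.
move=> mB BC fc; have mC := @measurable_cube_tuple R d.
have iB : mu.-integrable cube (EFin \o (\1_B : _ -> R)).
  apply: measurable_bounded_integrable => //.
  - by rewrite cube_tuple_measure ltry.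
  - exists 1; split; rewrite ?num_real// => K K1 u _ /=.
    apply: (le_trans _ (ltW K1)); rewrite indicE.
    by case: (_ \in _); rewrite ?normr1 ?normr0.
have iBf : mu.-integrable cube (EFin \o (fun u => \1_B u * f (row_of_tuple u))).
  have := integrable_indic_holder 0 mB.
  by under [X in EFin \o X]eq_fun do rewrite subr0.
have iBfc := integrable_indic_holder c mB.
rewrite -(Rintegral_indic mB BC) -!RintegralZl//.
rewrite -RintegralB//; last first.
  rewrite [X in _.-integrable _ X](_ : _ =
    fun u => (c%:E * (\1_B u)%:E)%E)//.
  exact: integrableZl.
under eq_Rintegral do rewrite [c * _]mulrC -mulrBr.
apply: (le_trans (le_normr_Rintegral mC iBfc)).
apply: le_Rintegral => //.
- exact: integrable_norm.
- rewrite [X in _.-integrable _ X](_ : _ =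
    fun u => (dl%:E * (\1_B u)%:E)%E)//.
  exact: integrableZl.
- move=> u cu; rewrite indicE; case: (boolP (u \in B)) => [/set_mem Bu|_].
    by rewrite mul1r mulr1 fc.
  by rewrite mul0r mulr0 normr0.
Qed.

Lemma indic_tuple_box (A : 'I_d -> set T) u :
  \1_(tuple_box A) u = \prod_i \1_(A i) (tnth u i) :> R.
Proof.
rewrite indicE; case: (boolP (u \in _)) => [/set_mem h|h].
  by rewrite big1// => i _; rewrite indicE mem_set//; exact: h.
have [i Ai] : exists i, ~ A i (tnth u i).
  by apply/existsNP => h'; move/negP: h; apply; exact/mem_set.
by rewrite (bigD1 i)//= indicE memNset// mul0r.
Qed.

(* The noiseless part of the observation. *)
Definition primitive x := integral_unit_cube
  (fun u => \1_[set v : 'rV[R]_d | forall i, 0 <= v ord0 i <= x ord0 i] u * f u).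

(** Inside the unit cube the lower constraint is automatic. With half-lines the indicator is a
    product whose coordinate differences are indicators of intervals []a, b]]. *)
Lemma primitiveE x : primitive x = (\int[mu]_(u in cube)
  (\1_(tuple_box (fun i => `]-oo, x ord0 i]%classic)) u * f (row_of_tuple u)))%R.
Proof.
apply: eq_Rintegral => u /set_mem cu; congr (_ * _).
rewrite !indicE; congr ((nat_of_bool _)%:R); apply/idP/idP => /set_mem h;
  apply/mem_set => i; have := h i; have := cu i; rewrite /= !in_itv/= !mxE.
- by move=> _ /andP[].
- by move=> /andP[-> _] ->.
Qed.

(** The alternating sum passes under the integral, where [sum_corner_sign] factors the indicators of
    the corners. *)
Lemma box_increment_primitive a b : (forall i, a ord0 i <= b ord0 i) ->
  box_increment primitive a b = (\int[mu]_(u in cube)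
  (\1_(tuple_box (fun i => `]a ord0 i, b ord0 i]%classic)) u *
   f (row_of_tuple u)))%R.
Proof.
move=> ab; rewrite box_incrementE.
under eq_bigr do rewrite primitiveE.
have mC := @measurable_cube_tuple R d.
have ig x : mu.-integrable cube (EFin \o (fun u =>
    \1_(tuple_box (fun i => `]-oo, x ord0 i]%classic)) u * f (row_of_tuple u))).
  have := @integrable_indic_holder
    (tuple_box (fun i => `]-oo, x ord0 i]%classic)) 0.
  under [X in EFin \o X]eq_fun do rewrite subr0.
  by apply; apply: measurable_tuple_box.
under eq_bigr do rewrite -RintegralZl//.
rewrite -Rintegral_sum//; last first.
  move=> e; rewrite [X in _.-integrable _ X](_ : _ = fun u =>
    ((corner_sign R e)%:E *
    (\1_(tuple_box (fun i => `]-oo, corner a b e ord0 i]%classic)) u *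
     f (row_of_tuple u))%:E)%E)//.
  by apply: integrableZl => //; exact: ig.
apply: eq_Rintegral => u _.
under eq_bigr do rewrite mulrA.
rewrite -mulr_suml; congr (_ * _).
under eq_bigr do rewrite indic_tuple_box.
rewrite indic_tuple_box.
under eq_bigr => e _ do under eq_bigr => i _ do rewrite mxE.
rewrite (sum_corner_sign (fun i (t : bool) =>
  \1_(`]-oo, (if t then b ord0 i else a ord0 i)]%classic) (tnth u i))).
apply: eq_bigr => i _ /=.
have := ab i; rewrite !indicE.
rewrite (_ : (tnth u i \in `]-oo, b ord0 i]%classic) = (tnth u i <= b ord0 i)).
  rewrite (_ : (tnth u i \in `]-oo, a ord0 i]%classic) = (tnth u i <= a ord0 i)).
    rewrite (_ : (tnth u i \in `]a ord0 i, b ord0 i]%classic) =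
      (a ord0 i < tnth u i <= b ord0 i)).
      move=> abi; case: (leP (tnth u i) (b ord0 i)) => h1;
        case: (leP (tnth u i) (a ord0 i)) => h2 //=; rewrite ?subrr ?subr0//.
      by have := le_trans h2 abi; rewrite leNgt h1.
    by rewrite mem_setE in_itv.
  by rewrite mem_setE in_itv.
by rewrite mem_setE in_itv.
Qed.

(** The box []a, b]] may differ from the dyadic cube on its faces, but it has volume [2^(-md)] and
    all its points are within [2^-m] of [x], so the average of [f] over it is close to [f x]. *)
Lemma box_increment_primitive_approx x m : unit_cube x ->
  `|2 ^+ (m * d) * box_increment primitive (lower_corner m x) (upper_corner m x)
    - f x| <= L * (2 ^- m) `^ alpha.
Proof.
move=> cx; set a := lower_corner m x; set b := upper_corner m x.
have ab i : a ord0 i < b ord0 i.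
  by rewrite upper_cornerE ltrDl invr_gt0 exp2n_gt0.
rewrite box_increment_primitive => [|i]; last exact/ltW.
set B := tuple_box _.
have mB : measurable B by exact: measurable_tuple_box.
have BE : mu B = (2 ^- (m * d))%:E.
  rewrite -(prod_corner_diff m x); apply: lebesgue_rd_box => // i.
  by rewrite lebesgue_measure_itv/= lte_fin ab.
have BC : B `<=` cube.
  move=> u Bu i; have := Bu i; rewrite /= in_itv/= => /andP[h1 h2].
  rewrite [row_of_tuple u _ _]mxE.
  have := unit_cube_lower_corner m x i; have := unit_cube_upper_corner m x i.
  by rewrite -/a -/b; lra.
have N0 : 0 < 2 ^+ (m * d) :> R by exact: exp2n_gt0.
have : `|(\int[mu]_(u in cube) (\1_B u * f (row_of_tuple u)))%R -
    f x * fine (mu B)| <= L * (2 ^- m) `^ alpha * fine (mu B).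
  apply: integral_indic_holder => // u Bu.
  have p0 : 0 <= 2 ^- m :> R by rewrite invr_ge0 ltW ?exp2n_gt0.
  apply: (le_trans (hf (BC _ Bu) cx)); rewrite ler_wpM2l//.
  rewrite ge0_ler_powR ?(ltW alpha_gt0) ?nnegrE ?normr_ge0//.
  apply: dyadic_cube_norm => // i; rewrite [row_of_tuple u _ _]mxE.
  by have := Bu i; rewrite /= in_itv/= => /andP[/ltW -> ->].
rewrite BE /= ler_pdivlMr//; apply: le_trans.
rewrite -[X in _ <= _ * X](gtr0_norm N0) -normrM mulrBl divfK ?gt_eqF//.
by rewrite mulrC.
Qed.

End box_integral.

(** * The noise *)

Lemma gaussian_rv_Lfun2 (R : realType) d0 (T : measurableType d0)
    (P : probability T R) (X : T -> R) :
  gaussian_rv P X -> X \in Lfun P 2%:E.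
Proof. by move=> [mX [m [s [_ lawX]]]]; exact: gaussian_Lfun2 lawX. Qed.

Section linear_combinations.
Context (R : realType) (d0 : measure_display) (T : measurableType d0)
  (P : probability T R) (J : Type).
Variables (c : J -> R) (Y : J -> T -> R).
Hypothesis Y2 : forall j, Y j \in Lfun P 2%:E.

Let Pfin : P [set: T] \is a fin_num := fin_num_measure P _ measurableT.

Lemma Lfun2_lincomb (r : seq J) :
  (fun w => \sum_(j <- r) c j * Y j w) \in Lfun P 2%:E.
Proof.
elim: r => [|j r IH].
  by under eq_fun do rewrite big_nil; exact: Lfun_cst.
under eq_fun do rewrite big_cons.
apply: (@Lfun2D _ _ _ _ (fun w => c j * Y j w)) => //.
under eq_fun do rewrite mulrC.
by apply: (@Lfun_scale _ _ _ _ (Y j)) => //; rewrite ler1n.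
Qed.

Lemma expectation_lincomb (r : seq J) : (forall j, 'E_P[Y j] = 0)%E ->
  ('E_P[(fun w => (\sum_(j <- r) c j * Y j w)%R)] = 0)%E.
Proof.
move=> Y0; elim: r => [|j r IH].
  by under eq_fun do rewrite big_nil; rewrite (expectation_cst P 0).
under eq_fun do rewrite big_cons mulrC.
have Y1 := Lfun_subset12 Pfin (Y2 j).
have S1 := Lfun_subset12 Pfin (Lfun2_lincomb r).
rewrite (@expectationD _ _ _ P (c j \o* Y j)) ?Lfun_scale//.
by rewrite expectationZl// Y0 mule0 add0e.
Qed.

Lemma covariance_lincomb (r : seq J) (Z : T -> R) (k : J -> R) :
  Z \in Lfun P 2%:E -> (forall j, covariance P (Y j) Z = (k j)%:E) ->
  covariance P (fun w => \sum_(j <- r) c j * Y j w) Z =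
  (\sum_(j <- r) c j * k j)%:E.
Proof.
move=> Z2 kE; have Z1 := Lfun_subset12 Pfin Z2; elim: r => [|j r IH].
  by under eq_fun do rewrite big_nil; rewrite big_nil (covariance_cst_l P 0).
under eq_fun do rewrite big_cons mulrC.
have Y1 := Lfun_subset12 Pfin (Y2 j).
rewrite (@covarianceDl _ _ _ P (c j \o* Y j))//; last 2 first.
- by rewrite Lfun_scale// ler1n.
- exact: Lfun2_lincomb.
rewrite covarianceZl//; last exact: Lfun2_mul_Lfun1.
by rewrite kE IH big_cons EFinD EFinM.
Qed.

End linear_combinations.

Section wiener_increments.
Context (R : realType) (d0 : measure_display) (T : measurableType d0)
  (P : probability T R) (d : nat) (W : 'rV[R]_d -> T -> R).
Hypothesis wW : wiener_process P W.

(** [enum_val] transports the combinations indexed by ['I_k] to any finite type: the corners of one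
    cube or, through a sum type, those of two cubes. *)
Lemma wiener_gaussian (J : finType) (c : J -> R) (t : J -> 'rV[R]_d) :
  (forall j, unit_cube (t j)) ->
  gaussian_rv P (fun w => \sum_j c j * W (t j) w).
Proof.
move=> ct; case: wW => gW _ _ _.
have := gW #|J| (fun i => c (enum_val i)) (fun i => t (enum_val i)) (fun i => ct _).
congr (gaussian_rv P); apply/funext => w.
by rewrite [RHS](reindex _ (onW_bij _ (enum_val_bij J))).
Qed.

Lemma wiener_Lfun2 x : unit_cube x -> W x \in Lfun P 2%:E.
Proof.
move=> cx; have := @wiener_gaussian 'I_1 (fun=> 1) (fun=> x) (fun=> cx).
move/gaussian_rv_Lfun2.
by under eq_fun do rewrite big_ord1 mul1r.
Qed.

Lemma wiener_lincomb_mean (J : finType) (c : J -> R) (t : J -> 'rV[R]_d) :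
  (forall j, unit_cube (t j)) ->
  ('E_P[(fun w => (\sum_j c j * W (t j) w)%R)] = 0)%E.
Proof.
move=> ct; apply: (@expectation_lincomb _ _ _ _ _ c (fun j => W (t j))) => j.
  exact: wiener_Lfun2.
by case: wW => _ + _ _; apply.
Qed.

(** Bilinearity of the covariance, used once in each argument, turns the variance into the double
    increment of the kernel. *)
Lemma wiener_increment_variance (K : R) (a b : 'rV[R]_d) :
  unit_cube a -> unit_cube b -> (forall i, a ord0 i <= b ord0 i) ->
  ('V_P[(fun w => (\sum_e K * corner_sign R e * W (corner a b e) w)%R)] =
   (K ^+ 2 * \prod_i (b ord0 i - a ord0 i))%:E)%E.
Proof.
move=> ca cb ab; have cc e := unit_cube_corner e ca cb.
have W2 e := wiener_Lfun2 (cc e).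
rewrite -(box_increment2_min ab) /variance.
pose g (x y : 'rV[R]_d) : R := \prod_i Num.min (x ord0 i) (y ord0 i).
have cov e e' : covariance P (W (corner a b e)) (W (corner a b e')) =
    (g (corner a b e) (corner a b e'))%:E.
  by case: wW => _ _ + _; apply.
pose cf (e : {ffun 'I_d -> bool}) := K * corner_sign R e.
pose Y e := W (corner a b e).
pose S (w : T) := \sum_e cf e * Y e w.
have S2 : S \in Lfun P 2%:E by exact: Lfun2_lincomb.
have YS e : covariance P (Y e) S =
    (\sum_e' cf e' * g (corner a b e') (corner a b e))%:E.
  rewrite covarianceC; exact: (@covariance_lincomb _ _ _ P _ cf Y W2 _ (Y e)
    (fun e' => g (corner a b e') (corner a b e)) (W2 e) (cov^~ e)).
rewrite -/(covariance P S S) (@covariance_lincomb _ _ _ P _ cf Y W2 _ S _ S2 YS).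
congr EFin; rewrite box_incrementE mulr_sumr; apply: eq_bigr => e _.
rewrite box_incrementE !mulr_sumr; apply: eq_bigr => e' _.
have -> : g (corner a b e') (corner a b e) = g (corner a b e) (corner a b e').
  by apply: eq_bigr => i _; rewrite minC.
by rewrite /cf /g; ring.
Qed.

End wiener_increments.

(** * The selection rule *)

(** Provides the explicit bounds under which the [sup] in [Crit] and the [inf] in [m_hat] behave as
    a supremum and an infimum. *)
Lemma bounded_family (R : realType) (f : nat -> R) N j : (j <= N)%N ->
  `|f j| <= \sum_(i < N.+1) `|f i|.
Proof.
move=> jN; rewrite (bigD1 (Ordinal (jN : (j < N.+1)%N)))//= lerDl.
by apply: sumr_ge0 => i _; exact: normr_ge0.
Qed.

Lemma bigminn_le N (s : seq nat) (Q : pred nat) m : m \in s -> Q m ->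
  (\big[minn/N]_(i <- s | Q i) i <= m)%N.
Proof.
move=> ms Qm; elim: s ms => // i s IH; rewrite inE big_cons.
case/predU1P => [<-|/IH]; first by rewrite Qm geq_minl.
by case: ifP => // _; apply: leq_trans; exact: geq_minr.
Qed.

Section selection_rule.
Context (R : realType) (d0 : measure_display) (T : measurableType d0)
  (P : probability T R) (d n : nat) (sigma p : R) (x0 : 'rV[R]_d)
  (Z : 'rV[R]_d -> T -> R).
Hypothesis n_gt0 : (0 < n)%N.
Hypothesis dn_gt0 : (0 < dn R d n)%N.
Local Notation models := (models R d n).
Local Notation Crit := (Crit P n sigma p x0 Z).
Local Notation pen := (pen n sigma p x0).
Local Notation pen_jm := (pen_jm P p x0 Z).
Local Notation T_hat := (T_hat x0 Z).
Local Notation m_hat := (m_hat P n sigma p x0 Z).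
Implicit Types (m j : nat) (w : T).

Lemma T_hat_sub_le m j w : models m -> models j -> (m <= j)%N ->
  `|T_hat m w - T_hat j w| <= Crit m w - pen m + pen_jm j m.
Proof.
move=> mm mj le_mj; rewrite -lerBlDr /Crit addrK.
apply: ub_le_sup; last by exists j.
pose f j := `|T_hat m w - T_hat j w| - pen_jm j m.
exists (\sum_(i < (dn R d n).+1) `|f i|) => _ [i [_ /andP[_ i_dn]] <-].
by apply: le_trans (bounded_family f i_dn); exact: ler_norm.
Qed.

Lemma Crit_le_of m w B : models m ->
  (forall j, models j -> (m <= j)%N ->
     `|T_hat m w - T_hat j w| - pen_jm j m <= B) ->
  Crit m w <= B + pen m.
Proof.
move=> mm HB; rewrite /Crit lerD2r; apply: ge_sup.
  by exists (`|T_hat m w - T_hat m w| - pen_jm m m); exists m.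
by move=> _ [j [mj jm] <-]; exact: HB.
Qed.

Lemma m_hatP w : models (m_hat w) /\
  forall m, models m -> Crit (m_hat w) w <= Crit m w + n%:R^-1.
Proof.
set E := [set Crit j w | j in models].
have infE : has_inf E.
  split; first by exists (Crit 1 w); exists 1%N.
  exists (- \sum_(i < (dn R d n).+1) `|Crit i w|) => _ [i /andP[_ i_dn] <-].
  rewrite lerNl; apply: le_trans (bounded_family (Crit^~ w) i_dn).
  by rewrite -normrN ler_norm.
have n0 : 0 < n%:R^-1 :> R by rewrite invr_gt0 ltr0n.
(* The slack [1/n] yields an admissible index without the infimum having to be attained. *)
have [_ [m mm <-] /ltW Cm] := inf_adherent n0 infE.
suff [mm' Cm'] : models (m_hat w) /\ Crit (m_hat w) w <= inf E + n%:R^-1.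
  split=> // j mj; apply: (le_trans Cm'); rewrite lerD2r.
  by apply: ge_inf; [case: infE|exists j].
rewrite /m_hat -/E.
set b := \big[minn/_]_(_ <= _ < _ | _) _.
have b_le : (b <= m)%N.
  by apply: bigminn_le => //; rewrite mem_index_iota.
have : b = dn R d n \/ models b /\ Crit b w <= inf E + n%:R^-1.
  rewrite /b big_nat_cond; elim/big_ind: _ => [|i j Hi Hj|i].
  - by left.
  - by rewrite /minn; case: ifP.
  - by move=> /andP[/andP[i1 i2] Ci]; right; split => //; apply/andP; split.
(* If the minimum equals the default [dn], then [dn <= m <= dn] for the admissible [m], so the
   default value is itself admissible. *)
case=> // bE; move: (mm) => /andP[m1 m2].
have -> : b = m by apply/eqP; rewrite eqn_leq b_le bE.
by [].
Qed.

Lemma pen_jm_diag m : pen_jm m m = 0.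
Proof.
rewrite /pen_jm /sigma2_jm.
rewrite (_ : (fun w => _) = cst 0); last by apply/funext => w; rewrite subrr.
by rewrite variance_cst sqrtr0 mulr0.
Qed.

Lemma pen_ge0 m : 0 <= pen m.
Proof. by rewrite mulr_ge0 ?sqrtr_ge0. Qed.

(** The index [j = m] contributes 0 to the supremum in [Crit]. *)
Lemma pen_le_Crit m w : models m -> pen m <= Crit m w.
Proof.
move=> mm; have := T_hat_sub_le w mm mm (leqnn m).
by rewrite subrr normr0 pen_jm_diag addr0 subr_ge0.
Qed.

(** The smaller of the two indices supplies its [Crit], and [pen_jm] costs twice the penalty of the
    larger one, itself at most its [Crit]. In either order this makes three values of [Crit], each
    at most [Crit m + 1/n]. *)
Lemma T_hat_m_hat_le m w : models m ->
  (forall i j, models i -> models j -> (i <= j)%N -> pen_jm j i <= 2 * pen j) ->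
  `|T_hat (m_hat w) w - T_hat m w| <= 3 * (Crit m w + n%:R^-1).
Proof.
move=> mm Hpen; have [mh Cmh] := m_hatP w.
have n0 : 0 <= n%:R^-1 :> R by rewrite invr_ge0.
have := Cmh _ mm; have := pen_le_Crit w mm; have := pen_le_Crit w mh.
have := pen_ge0 m; have := pen_ge0 (m_hat w).
have [le_hm|/ltnW le_mh] := leqP (m_hat w) m.
  by have := T_hat_sub_le w mh mm le_hm; have := Hpen _ _ mh mm le_hm; lra.
have := T_hat_sub_le w mm mh le_mh; have := Hpen _ _ mm mh le_mh.
by rewrite distrC; lra.
Qed.

End selection_rule.

(** * Risk of the selected estimator *)

(** The sum is at most three times its largest term. *)
Lemma powR_sum3_le (R : realType) (p a b c : R) : 0 < p ->
  0 <= a -> 0 <= b -> 0 <= c ->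
  (a + b + c) `^ p <= 3 `^ p * (a `^ p + b `^ p + c `^ p).
Proof.
move=> p0 a0 b0 c0.
have H z : 0 <= z -> a + b + c <= 3 * z ->
    (a + b + c) `^ p <= 3 `^ p * z `^ p.
  move=> z0 h; rewrite -powRM// ge0_ler_powR ?(ltW p0) ?nnegrE ?addr_ge0//.
  by rewrite mulr_ge0.
have := powR_ge0 a p; have := powR_ge0 b p; have := powR_ge0 c p => c1 b1 a1.
have [ab|/ltW ba] := leP a b.
  have [bc|/ltW cb] := leP b c.
    by apply: (le_trans (H _ c0 _)); [lra|rewrite ler_wpM2l ?powR_ge0//; lra].
  by apply: (le_trans (H _ b0 _)); [lra|rewrite ler_wpM2l ?powR_ge0//; lra].
have [ac|/ltW ca] := leP a c.
  by apply: (le_trans (H _ c0 _)); [lra|rewrite ler_wpM2l ?powR_ge0//; lra].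
by apply: (le_trans (H _ a0 _)); [lra|rewrite ler_wpM2l ?powR_ge0//; lra].
Qed.

Section estimator.
Context (R : realType) (d0 : measure_display) (T : measurableType d0)
  (P : probability T R) (d n : nat) (sigma p : R) (x0 : 'rV[R]_d)
  (W : 'rV[R]_d -> T -> R) (f : 'rV[R]_d -> R) (alpha L : R).
Hypothesis wW : wiener_process P W.
Hypothesis cx0 : unit_cube x0.
Hypothesis sigma_gt0 : 0 < sigma.
Hypothesis n_gt0 : (0 < n)%N.
Hypothesis p_ge1 : 1 <= p.
Hypothesis alpha_gt0 : 0 < alpha.
Hypothesis L_ge0 : 0 <= L.
Hypothesis hf : holder_class alpha L f.
Implicit Types (m j : nat) (w : T).

Local Notation Z := (observation n sigma f W).
Local Notation models := (models R d n).

Let p_gt0 : 0 < p. Proof. exact: lt_le_trans p_ge1. Qed.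

Definition noise_scale : R := sigma / Num.sqrt n%:R.
Local Notation K := noise_scale.

Lemma noise_scale_gt0 : 0 < K.
Proof. by rewrite divr_gt0// sqrtr_gt0 ltr0n. Qed.

Lemma noise_scale_sqr : K ^+ 2 = sigma ^+ 2 / n%:R.
Proof. by rewrite expr_div_n sqr_sqrtr. Qed.

Definition mean_hat m : R := 2 ^+ (m * d) *
  box_increment (primitive f) (lower_corner m x0) (upper_corner m x0).

Definition noise m w : R := \sum_e K * 2 ^+ (m * d) * corner_sign R e *
  W (corner (lower_corner m x0) (upper_corner m x0) e) w.

Lemma T_hatE m w : T_hat x0 Z m w = mean_hat m + noise m w.
Proof.
rewrite /T_hat s_hatE//.
rewrite (_ : (fun x => Z x w) = (fun x => primitive f x + K * W x w))//.
rewrite box_incrementD mulrDr; congr (_ + _).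
rewrite box_incrementE !mulr_sumr; apply: eq_bigr => e _; ring.
Qed.

Let cc m e :
  unit_cube (corner (lower_corner m x0) (upper_corner m x0) e).
Proof.
by apply: unit_cube_corner;
  [exact: unit_cube_lower_corner|exact: unit_cube_upper_corner].
Qed.

Lemma gaussian_noise m : gaussian_rv P (noise m).
Proof. exact: (wiener_gaussian wW _ (cc m)). Qed.

Lemma noise_mean m : ('E_P[noise m] = 0)%E.
Proof. exact: (wiener_lincomb_mean wW _ (cc m)). Qed.

Lemma noise_variance m : ('V_P[noise m] = (K ^+ 2 * 2 ^+ (m * d))%:E)%E.
Proof.
rewrite (wiener_increment_variance wW)//.
- rewrite prod_corner_diff; congr EFin; field.
  by rewrite expf_neq0.
- exact: unit_cube_lower_corner.
- exact: unit_cube_upper_corner.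
- by move=> i; rewrite upper_cornerE lerDl invr_ge0 ltW ?exp2n_gt0.
Qed.

(** Indexing by a sum type makes the difference a single combination of values of [W], whatever the
    relative position of the two sets of corners. *)
Let diff_noiseE j m : (fun w => noise j w - noise m w) =
  fun w => \sum_(e : {ffun 'I_d -> bool} + {ffun 'I_d -> bool})
    (match e with inl e => K * 2 ^+ (j * d) * corner_sign R e
     | inr e => - (K * 2 ^+ (m * d) * corner_sign R e) end) *
    W (match e with
       | inl e => corner (lower_corner j x0) (upper_corner j x0) e
       | inr e => corner (lower_corner m x0) (upper_corner m x0) e end) w.
Proof.
apply/funext => w; rewrite big_sumType/= -sumrN; congr (_ + _).
by apply: eq_bigr => e _; rewrite mulNr.
Qed.

Lemma gaussian_diff_noise j m :
  gaussian_rv P (fun w => noise j w - noise m w).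
Proof. by rewrite diff_noiseE; apply: (wiener_gaussian wW) => -[]. Qed.

Lemma diff_noise_mean j m : ('E_P[fun w => (noise j w - noise m w)%R] = 0)%E.
Proof. by rewrite diff_noiseE; apply: (wiener_lincomb_mean wW) => -[]. Qed.

(** [Var (X - Y) <= 2 Var X + 2 Var Y], because [Var (X + Y) >= 0]; the covariance between levels is
    never computed. *)
Lemma diff_noise_variance_le j m : (m <= j)%N ->
  fine ('V_P[fun w => (noise j w - noise m w)%R])%E <=
  4 * (K ^+ 2 * 2 ^+ (j * d)).
Proof.
move=> mj; have N2 i := gaussian_rv_Lfun2 (gaussian_noise i).
have Pfin : P [set: T] \is a fin_num := fin_num_measure P _ measurableT.
have := varianceB (N2 j) (N2 m); have := varianceD (N2 j) (N2 m).
have := variance_ge0 P (noise j \+ noise m).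
have N1 i := Lfun_subset12 Pfin (N2 i).
have cf := covariance_fin_num (N1 j) (N1 m) (Lfun2_mul_Lfun1 (N2 j) (N2 m)).
rewrite !noise_variance -(fineK cf) => + D B.
rewrite D B -!EFinM -EFinN -!EFinD lee_fin /=.
have : K ^+ 2 * 2 ^+ (m * d) <= K ^+ 2 * 2 ^+ (j * d).
  by rewrite ler_wpM2l ?sqr_ge0// ler_weXn2l ?ler1n// leq_mul2r mj orbT.
lra.
Qed.

Lemma sigma2_jmE j m : sigma2_jm P x0 Z j m =
  fine ('V_P[fun w => (noise j w - noise m w)%R])%E.
Proof.
rewrite /sigma2_jm.
rewrite (_ : (fun w => _) =
  (fun w => noise j w - noise m w) \+ cst (mean_hat j - mean_hat m)).
  by rewrite varianceD_cst_r//; exact/gaussian_rv_Lfun2/gaussian_diff_noise.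
by apply/funext => w /=; rewrite !T_hatE; ring.
Qed.

Lemma sigma2_mE m : sigma2_m n sigma x0 m = K ^+ 2 * 2 ^+ (m * d).
Proof. by rewrite /sigma2_m sum_phi_sqr// noise_scale_sqr. Qed.

Lemma x_m_ge0 m : 0 <= x_m d p m.
Proof.
by rewrite !mulr_ge0 ?(ltW p_gt0)// ln_ge0// exprn_ege1// ler1n.
Qed.

Lemma pen_jm_le j m : (m <= j)%N ->
  pen_jm P p x0 Z j m <= 2 * pen n sigma p x0 j.
Proof.
move=> mj; rewrite /pen_jm /pen -[x_jm d p j m]/(x_m d p j).
rewrite [leRHS]mulrCA ler_wpM2l ?sqrtr_ge0//.
rewrite sigma2_jmE sigma2_mE.
have s4 : Num.sqrt 4 = 2 :> R.
  by rewrite (_ : 4 = 2 ^+ 2) ?sqrtr_sqr ?ger0_norm//; ring.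
by rewrite -[X in _ <= X * _]s4 -sqrtrM// ler_wsqrtr// diff_noise_variance_le.
Qed.

Definition excess j m w : R := Num.max 0
  (`|noise j w - noise m w| - pen_jm P p x0 Z j m) `^ p.

(** Apply the Gaussian bound with [a^2 = 2 x_jm]: the factor [exp(- x_jm) = 2^(-pdj/2)] cancels the
    growth [2^(pdj/2)] of the [p]-th power of the standard deviation, which leaves a bound uniform
    in [j]. *)
Lemma excess_integral_le j m : (m <= j)%N ->
  (\int[P]_w (excess j m w)%:E <=
   (4 * expR (p ^+ 2) * (2 * K) `^ p)%:E)%E.
Proof.
move=> mj; rewrite /excess /pen_jm sigma2_jmE.
have K0 := noise_scale_gt0.
have x0' : 0 <= 2 * x_jm d p j m by rewrite mulr_ge0// -/(x_m d p j) x_m_ge0.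
apply: le_trans.
  apply: gaussian_excess_le; rewrite ?sqrtr_ge0//.
    exact: gaussian_diff_noise.
  exact: diff_noise_mean.
rewrite lee_fin -mulrA ler_wpM2l ?mulr_ge0 ?expR_ge0//.
set V := fine _; have VK : V <= 4 * (K ^+ 2 * 2 ^+ (j * d)).
  exact: diff_noise_variance_le.
have jd0 : 0 <= 2 ^+ (j * d) :> R by exact/ltW/exp2n_gt0.
have sV : Num.sqrt V <= 2 * K * (2 ^+ (j * d)) `^ 2^-1.
  rewrite powR12_sqrt// -(ger0_norm (mulr_ge0 (ler0n _ 2) (ltW K0))).
  rewrite -sqrtr_sqr -sqrtrM ?sqr_ge0// ler_wsqrtr//.
  by apply: (le_trans VK); rewrite le_eqVlt; apply/orP; left; apply/eqP; ring.
have : Num.sqrt V `^ p <= (2 * K * (2 ^+ (j * d)) `^ 2^-1) `^ p.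
  rewrite ge0_ler_powR ?(ltW p_gt0) ?nnegrE ?sqrtr_ge0//.
  by rewrite mulr_ge0 ?powR_ge0// mulr_ge0// ltW.
rewrite (powRM p (mulr_ge0 (ler0n R 2) (ltW K0)) (powR_ge0 _ _)) => h.
apply: (le_trans (ler_wpM2r (expR_ge0 _) h)).
have lnX i : ln (2 ^+ i) = i%:R * ln 2 :> R.
  by rewrite lnXn ?ltr0n// mulr_natl.
have -> : ((2 ^+ (j * d)) `^ 2^-1) `^ p =
    expR (2^-1 * p * (j%:R * d%:R * ln 2)) :> R.
  by rewrite -powRrM /powR gt_eqF ?exp2n_gt0// lnX natrM.
rewrite sqr_sqrtr// -[leLHS]mulrA ler_piMr ?powR_ge0//.
rewrite -expRD -[leRHS]expR0 ler_expR.
rewrite /x_jm lnX; lra.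
Qed.

(** The Gaussian excess bound at threshold 0. *)
Lemma noise_integral_le m :
  (\int[P]_w (`|noise m w| `^ p)%:E <=
   (4 * expR (p ^+ 2) * Num.sqrt (K ^+ 2 * 2 ^+ (m * d)) `^ p)%:E)%E.
Proof.
have := gaussian_excess_le (gaussian_noise m) (noise_mean m) p_gt0 (lexx 0).
have e0 : - 0 ^+ 2 / 2 = 0 :> R by ring.
rewrite noise_variance /= e0 expR0 mulr1.
under eq_integral do rewrite mul0r subr0 max_r//.
exact.
Qed.

Lemma mean_hat_approx m :
  `|mean_hat m - f x0| <= L * (2 ^- m) `^ alpha.
Proof. exact: box_increment_primitive_approx. Qed.

Definition bias m : R := L * (2 ^- m) `^ alpha.

Lemma bias_le m j : (m <= j)%N -> bias j <= bias m.
Proof.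
move=> mj; rewrite /bias ler_wpM2l// ge0_ler_powR ?(ltW alpha_gt0)//;
  rewrite ?nnegrE ?invr_ge0 ?(ltW (exp2n_gt0 _ _))//.
by rewrite lef_pV2 ?posrE ?exp2n_gt0// ler_weXn2l ?ler1n.
Qed.

(** The coefficient 7 is one bias for [T_hat m] itself plus three times the two biases contained in
    [Crit m]. *)
Lemma pointwise_risk m w : models m ->
  `|s_hat (fun x => Z x w) (m_hat P n sigma p x0 Z w) x0 - f x0| <=
  (7 * bias m + 3 * pen n sigma p x0 m + 3 / n%:R) + `|noise m w| +
  3 * (\sum_(j < (dn R d n).+1 | (m <= j)%N) excess j m w) `^ p^-1.
Proof.
move=> mm; set S := \sum_(j < _ | _) _.
have dn0 : (0 < dn R d n)%N by move: mm => /andP[m1 m2]; exact: leq_trans m2.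
have S0 : 0 <= S by apply: sumr_ge0 => j _; exact: powR_ge0.
have exS j : models j -> (m <= j)%N -> Num.max 0
    (`|noise j w - noise m w| - pen_jm P p x0 Z j m) <= S `^ p^-1.
  move=> /andP[_ jd] mj; set z := Num.max _ _.
  have z0 : 0 <= z by rewrite le_max lexx.
  (* Write [z] as [(z^p)^(1/p)], where [z^p] is one of the nonnegative terms of [S]. *)
  rewrite -[z]powRr1// -(@divff _ p) ?gt_eqF// powRrM.
  rewrite ge0_ler_powR ?invr_ge0 ?nnegrE ?powR_ge0 ?(ltW p_gt0)//.
  rewrite /S (bigD1 (Ordinal (jd : (j < (dn R d n).+1)%N)))//= lerDl.
  by apply: sumr_ge0 => i _; exact: powR_ge0.
have Cm : Crit P n sigma p x0 Z m w <=
    2 * bias m + S `^ p^-1 + pen n sigma p x0 m.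
  apply: Crit_le_of => // j mj le_mj.
  have := exS j mj le_mj; rewrite ge_max => /andP[_].
  have := mean_hat_approx m; have := mean_hat_approx j.
  have := bias_le le_mj.
  rewrite -/(bias m) -/(bias j) !T_hatE distrC => b1 b2 b3 b4.
  have : `|mean_hat m + noise m w - (mean_hat j + noise j w)| <=
      `|mean_hat m - f x0| + `|f x0 - mean_hat j| + `|noise m w - noise j w|.
    rewrite (_ : _ - _ = (mean_hat m - f x0) + (f x0 - mean_hat j) +
      (noise m w - noise j w)); last by ring.
    by rewrite (le_trans (ler_normD _ _))// lerD2r ler_normD.
  by rewrite (distrC (noise m w)); lra.
have Tm : `|T_hat x0 Z m w - f x0| <= bias m + `|noise m w|.
  rewrite T_hatE addrAC (le_trans (ler_normD _ _))// lerD2r.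
  exact: mean_hat_approx.
have := @T_hat_m_hat_le _ _ _ P d n sigma p x0 Z n_gt0 dn0 m w mm
  (fun i j _ _ ij => pen_jm_le ij).
rewrite -[s_hat _ _ _]/(T_hat x0 Z (m_hat P n sigma p x0 Z w) w) => h.
apply: (le_trans (ler_distD (T_hat x0 Z m w) _ _)).
by move: h Tm Cm; lra.
Qed.

Let measurable_excess j m : measurable_fun [set: T] (excess j m).
Proof.
have [mN _] := gaussian_diff_noise j m.
apply: (@measurableT_comp _ _ _ _ _ _ (fun x : R => x `^ p)) => //.
apply: measurable_maxr => //; apply: measurable_funB => //.
exact: measurableT_comp.
Qed.

Lemma risk_le m : models m ->
  ('E_P[fun w =>
     (`|s_hat (fun x => Z x w) (m_hat P n sigma p x0 Z w) x0 - f x0| `^ p)%R] <=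
  (3 `^ p * ((7 * bias m + 3 * pen n sigma p x0 m + 3 / n%:R) `^ p +
    4 * expR (p ^+ 2) * Num.sqrt (K ^+ 2 * 2 ^+ (m * d)) `^ p +
    3 `^ p * ((dn R d n).+1%:R * (4 * expR (p ^+ 2) * (2 * K) `^ p))))%:E)%E.
Proof.
move=> mm; set D := _ + _ + 3 / _.
have [mN _] := gaussian_noise m.
have mNp : measurable_fun [set: T] (fun w => `|noise m w| `^ p).
  apply: (@measurableT_comp _ _ _ _ _ _ (fun x : R => x `^ p)) => //.
  exact: measurableT_comp.
have D0 : 0 <= D.
  by rewrite !addr_ge0// ?mulr_ge0 ?powR_ge0 ?pen_ge0 ?invr_ge0.
pose S w : R := \sum_(j < (dn R d n).+1 | (m <= j)%N) excess j m w.
have S0 w : 0 <= S w by apply: sumr_ge0 => j _; exact: powR_ge0.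
have mS : measurable_fun [set: T] S.
  rewrite (_ : S = fun w => \sum_(j < (dn R d n).+1)
    if (m <= j)%N then excess j m w else 0).
    by apply: measurable_sum => j; case: (m <= j)%N.
  by apply/funext => w; rewrite /S big_mkcond.
rewrite unlock; apply: le_trans.
  (* From here on [m_hat] has disappeared: the dominating function involves only the fixed level
     [m], is measurable, and can be integrated term by term. *)
  apply: (@le_ge0_integral _ _ _ _ _ (fun w => (3 `^ p)%:E *
    ((D `^ p)%:E + (`|noise m w| `^ p)%:E + (3 `^ p)%:E * (S w)%:E))%E) => w.
    by rewrite lee_fin powR_ge0.
  rewrite -[((3 `^ p)%:E * (S w)%:E)%E]EFinM -!EFinD -EFinM lee_fin.
  have := pointwise_risk w mm; rewrite -/D -/(S w) => h.
  have q0 : 0 <= 3 * S w `^ p^-1 by rewrite mulr_ge0 ?powR_ge0.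
  apply: (@le_trans _ _ ((D + `|noise m w| + 3 * S w `^ p^-1) `^ p)).
    have r0 := le_trans (normr_ge0 _) h.
    by apply: ge0_ler_powR h; rewrite ?nnegrE// ltW.
  apply: (le_trans (powR_sum3_le p_gt0 D0 (normr_ge0 _) q0)).
  by rewrite (powRM _ _ (powR_ge0 _ _))// -powRrM mulVf ?gt_eqF// powRr1.
have mNe : measurable_fun [set: T] (fun w => (`|noise m w| `^ p)%:E).
  exact/measurable_EFinP.
have mSe : measurable_fun [set: T] (fun w => (S w)%:E).
  exact/measurable_EFinP.
rewrite ge0_integralZl_EFin ?powR_ge0//; last 2 first.
- by move=> w _; rewrite -[((3 `^ p)%:E * (S w)%:E)%E]EFinM -!EFinD lee_fin;
    rewrite !addr_ge0 ?mulr_ge0 ?powR_ge0.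
- by apply: emeasurable_funD; [exact: emeasurable_funD|exact: measurable_funeM].
rewrite EFinM lee_wpmul2l ?lee_fin ?powR_ge0//.
rewrite ge0_integralD//; last 4 first.
- by move=> w _; rewrite -EFinD lee_fin addr_ge0 ?powR_ge0.
- exact: emeasurable_funD.
- by move=> w _; rewrite -EFinM lee_fin mulr_ge0 ?powR_ge0.
- exact: measurable_funeM.
rewrite ge0_integralD//; last first.
  by move=> w _; rewrite lee_fin powR_ge0.
have -> : (\int[P]_w (D `^ p)%:E = (D `^ p)%:E)%E.
  by have := expectation_cst P (D `^ p); rewrite unlock.
rewrite !EFinD; apply: leeD.
  by apply: leeD => //; exact: noise_integral_le.
rewrite ge0_integralZl_EFin ?powR_ge0//; last first.
  by move=> w _; rewrite lee_fin.
rewrite EFinM lee_wpmul2l ?lee_fin ?powR_ge0//.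
pose exE (j : 'I_(dn R d n).+1) w : \bar R :=
  if (m <= j)%N then (excess j m w)%:E else 0%E.
rewrite (eq_integral (fun w => \sum_j exE j w)%E) => [|w _]; last first.
  rewrite /S big_mkcond/= -sumEFin; apply: eq_bigr => j _.
  by rewrite /exE; case: ifP.
rewrite ge0_integral_sum//; last 2 first.
- by move=> j; rewrite /exE; case: (m <= j)%N => //; exact/measurable_EFinP.
- by move=> j w _; rewrite /exE; case: ifP => // _; rewrite lee_fin powR_ge0.
set q := 4 * _ * _.
apply: (@le_trans _ _ (\sum_(j < (dn R d n).+1) q%:E)%E).
  apply: lee_sum => j _; rewrite /exE; case: (boolP (m <= j)%N) => [mj|_].
    exact: excess_integral_le.
  by rewrite integral0 lee_fin !mulr_ge0 ?expR_ge0 ?powR_ge0.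
by rewrite sumEFin sumr_const card_ord mulr_natl.
Qed.

End estimator.

(** * Balance of bias and noise, and the constants *)

Lemma ln2_ge_half (R : realType) : 1 / 2 <= ln 2 :> R.
Proof.
rewrite -ler_expR lnK ?posrE//.
have h := expR_ge1Dx (- (1 / 2) : R).
have e0 := expR_gt0 (1 / 2 : R).
have := expRxMexpNx_1 (1 / 2 : R); nra.
Qed.

Section level_choice.
Context (R : realType) (d n : nat) (sigma alpha L : R).
Hypothesis d_ge1 : (1 <= d)%N.
Hypothesis n_ge2 : (2 <= n)%N.
Hypothesis sigma_gt0 : 0 < sigma.
Hypothesis alpha_gt0 : 0 < alpha.
Hypothesis alpha_le1 : alpha <= 1.
Hypothesis L_gt0 : 0 < L.

Local Notation lam := (ln n%:R : R).
Local Notation K := (noise_scale n sigma).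

(** The common size of the bias and of the noise inflated by [sqrt (ln n)] at the balance point; its
    [p]-th power is the leading term of the risk bound. *)
Definition rate : R := L `^ (d%:R / (d%:R + 2 * alpha)) *
  (sigma ^+ 2 * lam / n%:R) `^ (alpha / (2 * alpha + d%:R)).

Lemma ln_n_ge_half : 1 / 2 <= lam.
Proof.
apply: (le_trans (ln2_ge_half R)); rewrite ler_ln ?posrE ?ler_nat//.
by rewrite ltr0n; exact: leq_trans n_ge2.
Qed.

(** With [B = sigma^2 ln n / n] and [D = d + 2 alpha], the equation [L^2 2^(-2 m alpha) = B 2^(md)]
    reads [m ln 2 = a / D] for [a = ln (L^2 / B)]. The level is the integer part of this solution;
    the hypotheses say [a >= D ln 2], hence [m >= 1], and [a d <= D ln n], hence [m <= dn]. *)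
Lemma level_choice :
  n%:R / (sigma ^+ 2 * lam) >= 2 `^ (d%:R + 2 * alpha) * L ^- 2 ->
  L ^+ 2 <= n%:R `^ (2 * alpha / d%:R) * sigma ^+ 2 * lam ->
  exists2 m, models R d n m &
    bias alpha L m <= 2 * rate /\ K ^+ 2 * 2 ^+ (m * d) * lam <= rate ^+ 2.
Proof.
have lam0 : 0 < lam by have := ln_n_ge_half; lra.
have n0 : 0 < n%:R :> R by rewrite ltr0n; exact: leq_trans n_ge2.
have d0 : 0 < d%:R :> R by rewrite ltr0n.
have s0 : 0 < sigma ^+ 2 by rewrite exprn_gt0.
have l2 : 0 < ln 2 :> R by have := ln2_ge_half R; lra.
set D : R := d%:R + 2 * alpha.
have D0 : 0 < D by rewrite addr_gt0// mulr_gt0.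
have L2 : 0 < L ^+ 2 by rewrite exprn_gt0.
set B : R := sigma ^+ 2 * lam / n%:R.
have B0 : 0 < B by rewrite divr_gt0// mulr_gt0.
pose l : R := ln L; pose b : R := ln B; pose a : R := 2 * l - b.
have lnL2 : ln (L ^+ 2) = 2 * l by rewrite lnXn// mulr_natl.
move=> h1 h2.
have a1 : D * ln 2 <= a.
  move: h1; rewrite -(invrK (n%:R / _)) invf_div -/B ler_pdivrMr// => h1.
  have : ln (2 `^ D) <= ln (B^-1 * L ^+ 2).
    by rewrite ler_ln// posrE ?powR_gt0// mulr_gt0// invr_gt0.
  by rewrite ln_powR lnM ?posrE ?invr_gt0// lnV ?posrE// lnL2 -/b /a; lra.
have a2 : a * d%:R <= D * lam.
  have : ln (L ^+ 2) <= ln (n%:R `^ (2 * alpha / d%:R) * (B * n%:R)).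
    rewrite ler_ln ?posrE//; last first.
      by apply: mulr_gt0; [exact: powR_gt0|exact: mulr_gt0].
    by rewrite divfK ?gt_eqF// mulrA.
  rewrite lnL2 lnM ?posrE ?powR_gt0 ?(mulr_gt0 B0)// ln_powR lnM ?posrE// -/b.
  rewrite -(ler_pM2r d0) => h; rewrite /a /D.
  suff : 2 * alpha / d%:R * lam * d%:R = 2 * alpha * lam by lra.
  by field; rewrite gt_eqF.
have a0 : 0 < a by apply: lt_le_trans a1; exact: mulr_gt0.
have Dl : 0 < D * ln 2 by exact: mulr_gt0.
have q0 : 0 <= a / (D * ln 2) by rewrite divr_ge0 ?ltW.
pose m := Num.truncn (a / (D * ln 2)).
have /andP[] := truncn_itv q0; rewrite -/m ler_pdivlMr// ltr_pdivrMr// => m1 m2.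
have expX i : 2 ^+ i = expR (i%:R * ln 2) :> R.
  by rewrite -[LHS]lnK ?posrE ?exprn_gt0// lnXn// mulr_natl.
have aD : a = a / D * D by rewrite divfK ?gt_eqF.
have rateE : rate = expR (l - alpha * (a / D)).
  rewrite /rate /powR !gt_eqF// -/l -/b -expRD; congr expR.
  by rewrite addrC -[_ + d%:R]addrC -/D /a /D; field; rewrite gt_eqF.
set q : R := a / D in aD rateE.
have m1' : m%:R * ln 2 <= q.
  by rewrite -(ler_pM2r D0) -aD; move: m1; lra.
have m2' : q < (m%:R + 1) * ln 2.
  by rewrite -(ltr_pM2r D0) -aD; move: m2; rewrite -natr1; lra.
exists m; last split.
- apply/andP; split; first by rewrite truncn_ge_nat// ler_pdivlMr// mul1r.
  have : 0 <= lam / (d%:R * ln 2) by rewrite divr_ge0 ?mulr_ge0 ?ltW.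
  move=> /truncn_ge_nat ->; rewrite ler_pdivlMr ?mulr_gt0//.
  rewrite -(ler_pM2r D0); apply: le_trans (_ : a * d%:R <= _); last by lra.
  have := ler_wpM2r (ltW d0) m1; lra.
- rewrite /bias rateE.
  have -> : (2 ^- m) `^ alpha = expR (- alpha * (m%:R * ln 2)) :> R.
    rewrite /powR gt_eqF ?invr_gt0 ?exp2n_gt0// lnV ?posrE ?exp2n_gt0//.
    by rewrite expX expRK; congr expR; ring.
  rewrite -{1}(lnK (L_gt0 : L \is Num.pos)) -/l -expRD.
  rewrite -[X in _ <= X * _](lnK (ltr0n R 2 : 2 \is Num.pos)) -expRD ler_expR.
  (* Rounding down loses less than one level, which costs a factor [2^alpha <= 2] in the bias; the
     noise only decreases. *)
  have : alpha * q <= alpha * ((m%:R + 1) * ln 2) by rewrite ler_wpM2l// ltW.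
  have : alpha * ln 2 <= ln 2 by rewrite ler_piMl// ltW.
  lra.
- rewrite noise_scale_sqr rateE.
  have -> : sigma ^+ 2 / n%:R * 2 ^+ (m * d) * lam = B * 2 ^+ (m * d).
    by rewrite /B; move: (2 ^+ (m * d)) => N; ring.
  have -> : B = expR b by rewrite lnK.
  rewrite expX -expRD -(expRM_natl 2) ler_expR.
  have : m%:R * ln 2 * d%:R <= q * d%:R by rewrite ler_wpM2r// ltW.
  have : a = 2 * l - b by [].
  by rewrite natrM aD /D; lra.
Qed.

End level_choice.

Section numerical_bound.
Context (R : realType) (d n : nat) (sigma p alpha L : R) (x0 : 'rV[R]_d).
Hypothesis d_ge1 : (1 <= d)%N.
Hypothesis n_ge2 : (2 <= n)%N.
Hypothesis sigma_gt0 : 0 < sigma.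
Hypothesis p_ge1 : 1 <= p.
Hypothesis alpha_gt0 : 0 < alpha.
Hypothesis L_gt0 : 0 < L.
Hypothesis cx0 : unit_cube x0.

Local Notation lam := (ln n%:R : R).
Local Notation K := (noise_scale n sigma).
Local Notation Q := (rate d n sigma alpha L).

Let p_gt0 : 0 < p. Proof. exact: lt_le_trans p_ge1. Qed.

Lemma rate_ge0 : 0 <= Q.
Proof. by rewrite mulr_ge0 ?powR_ge0. Qed.

Lemma powR_rate : Q `^ p = L `^ (p * d%:R / (d%:R + 2 * alpha)) *
  (sigma ^+ 2 * lam / n%:R) `^ (p * alpha / (2 * alpha + d%:R)).
Proof.
rewrite (powRM p (powR_ge0 _ _) (powR_ge0 _ _)) -!powRrM.
by congr (_ `^ _ * _ `^ _); ring.
Qed.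

(** [m <= dn] gives [2 x_m <= p ln n], so the penalty is at most [sqrt p * Q], and [sqrt p <= p]
    since [p >= 1]. *)
Lemma pen_le_rate m : models R d n m -> K ^+ 2 * 2 ^+ (m * d) * lam <= Q ^+ 2 ->
  pen n sigma p x0 m <= p * Q.
Proof.
move=> /andP[_ mn] vQ; have lam0 := ln_n_ge_half R n_ge2.
have d0 : 0 < d%:R :> R by rewrite ltr0n.
have l2 : 0 < ln 2 :> R by have := ln2_ge_half R; lra.
rewrite /pen sigma2_mE//; set v := K ^+ 2 * _ in vQ *.
have v0 : 0 <= v by rewrite mulr_ge0 ?sqr_ge0// ltW ?exp2n_gt0.
have xm : 2 * x_m d p m <= p * lam.
  have : m%:R <= lam / (d%:R * ln 2).
    rewrite -truncn_ge_nat// divr_ge0 ?mulr_ge0 ?(ltW l2)//; lra.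
  rewrite ler_pdivlMr ?mulr_gt0// => h.
  rewrite /x_m lnXn// -[ln 2 *+ m]mulr_natl.
  have := ler_wpM2l (ltW p_gt0) h; lra.
have xm0 : 0 <= 2 * x_m d p m by rewrite mulr_ge0// x_m_ge0.
rewrite -sqrtrM// -(ger0_norm (mulr_ge0 (ltW p_gt0) rate_ge0)) -sqrtr_sqr.
rewrite ler_wsqrtr//.
apply: (le_trans (ler_wpM2r v0 xm)).
rewrite exprMn.
apply: (@le_trans _ _ (p * Q ^+ 2)).
  by rewrite -mulrA ler_wpM2l ?(ltW p_gt0)// mulrC.
by rewrite ler_wpM2r ?sqr_ge0// expr2 ler_peMr// ltW.
Qed.

(** [ln 2 >= 1/2] gives [dn <= 2 ln n], and the extra 1 is also at most [2 ln n]. *)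
Lemma dn_le : (dn R d n).+1%:R <= 4 * lam.
Proof.
have lam0 := ln_n_ge_half R n_ge2; have l2 := ln2_ge_half R.
have d1 : 1 <= d%:R :> R by rewrite ler1n.
have : (dn R d n)%:R <= lam / (d%:R * ln 2).
  by rewrite truncn_le divr_ge0 ?mulr_ge0//; lra.
rewrite ler_pdivlMr ?mulr_gt0//; [|lra|lra].
rewrite -natr1; have : 0 <= (dn R d n)%:R :> R by [].
set k := _%:R => k0 h.
have : k * (1 * (1 / 2)) <= k * (d%:R * ln 2).
  by rewrite ler_wpM2l// ler_pM//; lra.
lra.
Qed.

Lemma noise_scale_powR : K `^ p = sigma `^ p * (n%:R `^ (p / 2))^-1.
Proof.
rewrite /noise_scale powRM ?invr_ge0 ?sqrtr_ge0 ?(ltW sigma_gt0)//.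
congr (_ * _); rewrite -powR12_sqrt// -!powRN -powRrM.
by congr powR; ring.
Qed.

(** Bias, penalty and noise at level [m] are multiples of [Q], with [14 = 7 * 2]; the terms in [1/n]
    and the excesses are of order [ln n / n^(p/2)], with [16 = 4 * 4] by [dn_le]. Outside [Q],
    [sigma] enters only through [K^p], so the coefficient of [Q^p] is free of it. *)
Lemma risk_numerical_bound m : models R d n m ->
  bias alpha L m <= 2 * Q -> K ^+ 2 * 2 ^+ (m * d) * lam <= Q ^+ 2 ->
  3 `^ p * ((7 * bias alpha L m + 3 * pen n sigma p x0 m + 3 / n%:R) `^ p +
    4 * expR (p ^+ 2) * Num.sqrt (K ^+ 2 * 2 ^+ (m * d)) `^ p +
    3 `^ p * ((dn R d n).+1%:R * (4 * expR (p ^+ 2) * (2 * K) `^ p))) <=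
  3 `^ p * (3 `^ p * (14 `^ p + (3 * p) `^ p) + 4 * expR (p ^+ 2) * 2 `^ p) *
    Q `^ p +
  3 `^ p * (3 `^ p * (3 `^ p * 2) +
    3 `^ p * (16 * expR (p ^+ 2) * 2 `^ p * sigma `^ p)) *
    (lam / n%:R `^ (p / 2)).
Proof.
move=> mm bQ vQ; have penQ := pen_le_rate mm vQ.
have lam0 := ln_n_ge_half R n_ge2; have Q0 := rate_ge0.
have n1 : 1 <= n%:R :> R by rewrite ler1n; exact: leq_trans n_ge2.
have n0 : 0 < n%:R :> R by exact: lt_le_trans n1.
have p0 := p_gt0.
set E := expR (p ^+ 2); have E0 : 0 < E by exact: expR_gt0.
have B0 : 0 <= bias alpha L m by rewrite mulr_ge0 ?powR_ge0// ltW.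
have P0 : 0 <= pen n sigma p x0 m by exact: pen_ge0.
set u := (n%:R `^ (p / 2))^-1; have u0 : 0 < u by rewrite invr_gt0 powR_gt0.
have t3 : 0 < 3 `^ p :> R by rewrite powR_gt0.
have t2 : 0 < 2 `^ p :> R by rewrite powR_gt0.
have D_le : (7 * bias alpha L m + 3 * pen n sigma p x0 m + 3 / n%:R) `^ p <=
    3 `^ p * ((14 `^ p + (3 * p) `^ p) * Q `^ p + 3 `^ p * 2 * (lam * u)).
  have inv0 : 0 <= 3 / n%:R :> R by rewrite divr_ge0// ltW.
  apply: (@le_trans _ _ ((14 * Q + 3 * p * Q + 3 / n%:R) `^ p)).
    by apply: ge0_ler_powR; rewrite ?(ltW p0) ?nnegrE//;
      do ?apply: addr_ge0 => //; do ?apply: mulr_ge0 => //; lra.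
  apply: le_trans.
    by apply: powR_sum3_le => //; do ?apply: mulr_ge0 => //; lra.
  rewrite ler_wpM2l ?(ltW t3)//.
  rewrite (powRM p (ler0n R 14) Q0) (powRM p (_ : 0 <= 3 * p) Q0); last lra.
  rewrite -mulrDl lerD2l (powRM p (ler0n R 3)) ?invr_ge0 ?(ltW n0)//.
  rewrite -mulrA ler_wpM2l ?(ltW t3)//.
  (* [n^(-p) <= n^(-p/2)], and the factor 1 is absorbed by [2 ln n >= 1]. *)
  have : n%:R^-1 `^ p <= u.
    rewrite -powR_inv1 ?(ltW n0)// -powRrM mulN1r powRN.
    rewrite lef_pV2 ?posrE ?powR_gt0// ler_powR//; lra.
  by nra.
have S_le : Num.sqrt (K ^+ 2 * 2 ^+ (m * d)) `^ p <= 2 `^ p * Q `^ p.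
  have Q20 : 0 <= 2 * Q by exact: mulr_ge0.
  rewrite -powRM//; apply: ge0_ler_powR; rewrite ?(ltW p0) ?nnegrE ?sqrtr_ge0//.
  rewrite -(ger0_norm Q20) -sqrtr_sqr ler_wsqrtr//.
  have : 0 <= K ^+ 2 * 2 ^+ (m * d) :> R.
    by rewrite mulr_ge0 ?sqr_ge0// ltW ?exp2n_gt0.
  (* [ln n >= 1/2] yields [K^2 2^(md) <= 2 Q^2 <= 4 Q^2]. *)
  move=> v0; have := ler_wpM2l v0 lam0; have := sqr_ge0 Q.
  by move: vQ; rewrite exprMn; lra.
have K0 : 0 <= K by rewrite ltW// noise_scale_gt0//; exact: leq_trans n_ge2.
have X_le : (dn R d n).+1%:R * (4 * E * (2 * K) `^ p) <=
    16 * E * 2 `^ p * sigma `^ p * (lam * u).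
  rewrite powRM// noise_scale_powR -/u.
  apply: (le_trans (ler_wpM2r _ dn_le)).
    by rewrite !mulr_ge0 ?powR_ge0 ?(ltW E0)// ltW.
  by rewrite le_eqVlt; apply/orP; left; apply/eqP; ring.
rewrite -[X in _ <= X + _]mulrA -[X in _ <= _ + X]mulrA -mulrDr.
rewrite ler_wpM2l ?(ltW t3)//.
have := ler_wpM2l (ltW (mulr_gt0 (ltr0n R 4) E0)) S_le.
have := ler_wpM2l (ltW t3) X_le.
move: D_le; rewrite -/u; lra.
Qed.

End numerical_bound.

Theorem corollary3 (R : realType) (d : nat) (p alpha : R)
    (d_ge1 : (1 <= d)%N) (p_ge1 : 1 <= p)
    (alpha_gt0 : 0 < alpha) (alpha_le1 : alpha <= 1) :
  exists C : R, forall sigma : R, 0 < sigma ->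
  exists Csigma : R,
  forall (x0 : 'rV[R]_d), unit_cube x0 ->
  forall (L : R), 0 < L ->
  forall (n : nat), (2 <= n)%N ->
    n%:R / (sigma ^+ 2 * ln n%:R) >= 2 `^ (d%:R + 2 * alpha) * L ^- 2 ->
    L ^+ 2 <= n%:R `^ (2 * alpha / d%:R) * sigma ^+ 2 * ln n%:R ->
  forall (d0 : measure_display) (T : measurableType d0) (P : probability T R)
    (W : 'rV[R]_d -> T -> R), wiener_process P W ->
  (ereal_sup
     [set 'E_P[fun w =>
          let Z := observation n sigma s W in
          (`| s_hat (fun x => Z x w) (m_hat P n sigma p x0 Z w) x0 - s x0 |
            `^ p)%R]
     | s in holder_class alpha L]
   <= (C * L `^ (p * d%:R / (d%:R + 2 * alpha))
         * (sigma ^+ 2 * ln n%:R / n%:R)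
             `^ (p * alpha / (2 * alpha + d%:R))
       + Csigma * (ln n%:R / n%:R `^ (p / 2)))%:E)%E.
Proof.
exists (3 `^ p * (3 `^ p * (14 `^ p + (3 * p) `^ p) +
  4 * expR (p ^+ 2) * 2 `^ p)) => sigma sigma_gt0.
exists (3 `^ p * (3 `^ p * (3 `^ p * 2) +
  3 `^ p * (16 * expR (p ^+ 2) * 2 `^ p * sigma `^ p))).
move=> x0 cx0 L L_gt0 n n_ge2 An nL d0 T P W wW.
have n_gt0 : (0 < n)%N by exact: leq_trans n_ge2.
(* The level is fixed before the function [f] is introduced, so a single bound serves the whole
   Hölder class. *)
have [m mm [bm vm]] :=
  level_choice d_ge1 n_ge2 sigma_gt0 alpha_gt0 alpha_le1 L_gt0 An nL.
apply: ge_ereal_sup => _ [f hf <-].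
apply: le_trans (risk_le wW cx0 sigma_gt0 n_gt0 p_ge1 alpha_gt0 (ltW L_gt0)
  hf mm) _.
rewrite lee_fin -[leRHS]/(_ * _ * _ + _) -(mulrA _ (L `^ _)) -powR_rate//.
exact: risk_numerical_bound.
Qed.
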